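(* Consider a standard protocol (as defined in the context) consisting of $r=r_S+r_L$ rounds, of which $r_S$ are stabilizer measurement rounds and $r_L$ are PSC measurement rounds, let $w_c$ and $w_q$ be the maximum row weight and maximum column weight of the parity check matrix $H$ of the measured stabilizers, and let $\ell$ be the number of tensor factors $V_i$ of the measured transversal PSC $\bar U$. Then any single-qubit circuit-level Pauli error propagates through this protocol to an end-of-circuit Clifford error consisting of $O\big(r^2 w_q(w_c+\ell)\big)$ one- and two-qubit Clifford gates.
   Context: Paulis are tensor products of $I,X,Y,Z$ times a phase in $\{\pm1,\pm i\}$; a Clifford maps Paulis to Paulis under conjugation; a Pauli-Square-Root Clifford (PSC) is a non-Pauli Clifford whose square is a Pauli. For a unitary $U$, $C(U)=|0\rangle\langle0|\otimes I+|1\rangle\langle1|\otimes U$. Setting: data qubits encode a stabilizer code; a subset $S_M=\{g_1,\dots,g_m\}$ of its stabilizers, each $g_i=\bigotimes_j P^{(i)}_j$ a tensor product of single-qubit Paulis, is described by a binary parity check matrix $H$ (rows = elements of $S_M$, columns = qubits, entry 1 iff the stabilizer acts nontrivially on the qubit); $w_c$ is the maximum number of qubits any $g_i$ acts on and $w_q$ the maximum number of $g_i$ acting nontrivially on a single qubit. A transversal logical PSC is $\bar U=\bigotimes_{i=1}^{\ell}V_i$, with the $V_i$ PSCs of pairwise disjoint support, each acting on $O(1)$ qubits, and $\bar U^2=I$. A standard protocol is a circuit consisting of $r$ rounds in an arbitrary order, each either (i) a stabilizer measurement round: for each $g_i$ a fresh ancilla prepared in $|+\rangle$ controls the gates $C(P^{(i)}_j)$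 onto the qubits in the support of $g_i$, or (ii) a PSC measurement round: a fresh ancilla in $|+\rangle$ controls $C(V_i)$ for $i=1,\dots,\ell$; ancillas are never reused and all ancilla measurements (in the $X$ basis) are deferred to the end of the circuit. A circuit-level Pauli error is a Pauli $E$ inserted at some location, i.e. the circuit $W=W_2W_1$ becomes $W_2EW_1$; it propagates to the end-of-circuit error $C_{\mathrm{prop}}=W_2EW_2^{\dagger}$, so that $W_2EW_1=C_{\mathrm{prop}}W$. *)

(* Defs.v *)
From HB Require Import structures.
From mathcomp Require Import all_boot all_order all_algebra algC.
Set Implicit Arguments. Unset Strict Implicit. Unset Printing Implicit Defensive.
Import Order.TTheory GRing.Theory Num.Theory.
Local Open Scope ring_scope.

(* computational basis states of the qubits indexed by the finite type T *)
Definition basis (T : finType) := {ffun T -> bool}.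

(* operators on the qubits T: matrix entries <x|A|y> *)
Definition op (T : finType) := basis T -> basis T -> algC.
Definition state (T : finType) := basis T -> algC.

Definition idop (T : finType) : op T := fun x y => (x == y)%:R.
Definition mulop (T : finType) (A B : op T) : op T :=
  fun x y => \sum_(z : basis T) A x z * B z y.
Definition adj (T : finType) (A : op T) : op T := fun x y => (A y x)^*.
Definition scaleop (T : finType) (c : algC) (A : op T) : op T :=
  fun x y => c * A x y.
Definition apply_op (T : finType) (A : op T) (psi : state T) : state T :=
  fun x => \sum_(y : basis T) A x y * psi y.

(* single-qubit Paulis: 0 = I, 1 = X, 2 = Y, 3 = Z ; entries <a|sigma|b> *)
Definition sigma (k : 'I_4) (a b : bool) : algC :=
  match val k with
  | 0 => (a == b)%:R
  | 1 => (a != b)%:R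
  | 2 => if a == b then 0 else if a then 'i else - 'i
  | _ => if a == b then (if a then -1 else 1) else 0
  end.

Definition pauli_tensor (T : finType) (c : algC) (p : T -> 'I_4) : op T :=
  fun x y => c * \prod_(q : T) sigma (p q) (x q) (y q).

Definition is_pauli (T : finType) (P : op T) : Prop :=
  exists (c : algC) (p : T -> 'I_4), c ^+ 4 = 1 /\ P = pauli_tensor c p.

Definition is_unitary (T : finType) (U : op T) : Prop :=
  mulop U (adj U) = @idop T /\ mulop (adj U) U = @idop T.

Definition is_clifford (T : finType) (U : op T) : Prop :=
  is_unitary U /\
  forall P : op T, is_pauli P -> is_pauli (mulop (mulop U P) (adj U)).

(* Pauli-square-root Clifford: non-Pauli Clifford whose square is a Pauli *)
Definition is_PSC (T : finType) (V : op T) : Prop :=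
  is_clifford V /\ ~ is_pauli V /\ is_pauli (mulop V V).

(* the operator G on qubits S placed on the qubits g s of T (g injective),
   identity on the other qubits of T *)
Definition embed (S T : finType) (g : S -> T) (G : op S) : op T :=
  fun x y => G [ffun s => x (g s)] [ffun s => y (g s)] *
             [forall t, (t \notin codom g) ==> (x t == y t)]%:R.

(* C(G) = |0><0| (x) I + |1><1| (x) G, control qubit c, targets g *)
Definition ctrl (S T : finType) (c : T) (g : S -> T) (G : op S) : op T :=
  fun x y => if x c && y c then embed g G x y
             else if ~~ x c && ~~ y c then (x == y)%:R else 0.

Definition small_clifford_gate (T : finType) (U : op T) : Prop :=
  exists (k : nat) (g : 'I_k -> T) (G : op 'I_k),
    [/\ (k = 1 \/ k = 2)%N, injective g, is_clifford G & U = embed g G].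

(* circuit given by a time-ordered gate list [g1; ...; gT]: gT ... g1 *)
Definition circ (T : finType) (gs : seq (op T)) : op T :=
  foldl (fun acc g => mulop g acc) (@idop T) gs.

Fixpoint all_prop (A : Type) (P : A -> Prop) (s : seq A) : Prop :=
  if s is a :: s' then P a /\ all_prop P s' else True.

Definition single_qubit_pauli (T : finType) (E : op T) : Prop :=
  exists (c : algC) (q0 : T) (a : 'I_4),
    c ^+ 4 = 1 /\ E = pauli_tensor c (fun q => if q == q0 then a else ord0).

Record protocol := Protocol {
  pn : nat;                                   (* number of data qubits *)
  pm : nat;                                   (* |S_M| *)
  pl : nat;                                   (* ell: number of factors V_i *)
  pr : nat;                                   (* number of rounds *)
  pP : 'I_pm -> 'I_pn -> 'I_4;                (* g_i = (x)_j P^(i)_j *)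
  pk : 'I_pl -> nat;                          (* V_i acts on pk i qubits *)
  pf : forall i : 'I_pl, 'I_(pk i) -> 'I_pn;  (* the support of V_i *)
  pV : forall i : 'I_pl, op 'I_(pk i);
  prk : 'I_pr -> bool;        (* true: stabilizer round, false: PSC round *)
  psched : 'I_pr -> seq ('I_pm * 'I_pn);  (* gate order in a stabilizer round *)
  plsched : 'I_pr -> seq 'I_pl }.         (* gate order in a PSC round *)

Arguments pf {_} _ _.
Arguments pV {_} _.
Arguments pk {_} _.
Arguments pP {_} _ _.
Arguments prk {_} _.
Arguments psched {_} _.
Arguments plsched {_} _.

Section Protocol.
Variable P : protocol.

Definition Hmx (i : 'I_(pm P)) (j : 'I_(pn P)) : bool := pP i j != ord0.

Definition wc : nat := \max_(i < pm P) #|[set j | Hmx i j]|.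
Definition wq : nat := \max_(j < pn P) #|[set i | Hmx i j]|.

Definition stab_anc := {x : 'I_(pr P) * 'I_(pm P) | prk x.1}.
Definition psc_anc := {t : 'I_(pr P) | ~~ prk t}.

(* all qubits: data qubits + one fresh ancilla per stabilizer per
   stabilizer round + one fresh ancilla per PSC round *)
Definition qubit : finType := ('I_(pn P) + stab_anc + psc_anc)%type.

Definition data (j : 'I_(pn P)) : qubit := inl (inl j).

Definition gen (i : 'I_(pm P)) : op 'I_(pn P) := pauli_tensor 1 (pP i).

Definition Ubar : op 'I_(pn P) :=
  foldr (fun (i : 'I_(pl P)) acc => mulop (embed (pf i) (pV i)) acc) (@idop _) (enum 'I_(pl P)).

Definition sigma1 (a : 'I_4) : op 'I_1 := fun x y => sigma a (x ord0) (y ord0).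

Definition stab_round_gates (t : 'I_(pr P)) : seq (op qubit) :=
  pmap (fun ij : 'I_(pm P) * 'I_(pn P) =>
          omap (fun a : stab_anc =>
                  ctrl (inl (inr a) : qubit) (fun _ : 'I_1 => data ij.2)
                       (sigma1 (pP ij.1 ij.2)))
               (insub (t, ij.1) : option stab_anc))
       (psched t).

Definition psc_round_gates (t : 'I_(pr P)) : seq (op qubit) :=
  match (insub t : option psc_anc) with
  | Some a => [seq ctrl (inr a : qubit) (fun q => data (pf i q)) (pV i)
              | i <- plsched t]
  | None => [::]
  end.

Definition round_gates (t : 'I_(pr P)) : seq (op qubit) :=
  if prk t then stab_round_gates t else psc_round_gates t.

Definition gates : seq (op qubit) :=
  flatten [seq round_gates t | t <- enum 'I_(pr P)].

Definition in_code (Ss : seq (op 'I_(pn P))) (psi : state 'I_(pn P)) : Prop :=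
  all_prop (fun g => apply_op g psi = psi) Ss.

Definition valid_protocol (s : nat) : Prop :=
  [/\
      forall t, prk t ->
        perm_eq (psched t)
                [seq ij <- enum {: 'I_(pm P) * 'I_(pn P)}
                 | Hmx ij.1 ij.2],
      forall t, ~~ prk t -> perm_eq (plsched t) (enum 'I_(pl P)),
      (* V_i are PSCs on O(1) qubits with pairwise disjoint supports *)
      (forall i : 'I_(pl P), [/\ injective (pf i), is_PSC (pV i) & (pk i <= s)%N]),
      (forall (i i' : 'I_(pl P)) (a : 'I_(pk i)) (b : 'I_(pk i')),
          i != i' -> pf i a != pf i' b) &
      mulop Ubar Ubar = @idop _ /\
      exists Ss : seq (op 'I_(pn P)),
        [/\ all_prop (@is_pauli _) Ss,
            (exists psi, in_code Ss psi /\ psi <> (fun _ => 0)),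
            (forall i, exists sg : algC, (sg = 1 \/ sg = -1) /\
                forall psi, in_code Ss psi ->
                  apply_op (scaleop sg (gen i)) psi = psi) &
            (forall psi, in_code Ss psi -> in_code Ss (apply_op Ubar psi))]].

End Protocol.

(* Main.v *)
From HB Require Import structures.
From mathcomp Require Import all_boot all_order all_algebra algC boolp.
From mathcomp Require Import zify ring.
Require Import Defs.
Set Implicit Arguments. Unset Strict Implicit. Unset Printing Implicit Defensive.
Import Order.TTheory GRing.Theory Num.Theory.
Local Open Scope ring_scope.

(** Every gate of the circuit is controlled by an ancilla and acts inside one block
    of data qubits, a block being the support of some [V_i] or a single qubit outside
    all of them; gates on different blocks commute. Hence an error inside a block is
    only affected by the at most [r] gates [C(V_i)] and [O(r w_q)] controlled Paulis
    of that block.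

    Let [m x] be the propagated error on the block when the ancillas are in the basis
    state [x], starting from a Pauli or from [V^{+-1}]. As [V^2] is a Pauli,
    commutators of Paulis with [V] commute with [V] up to sign, and it follows that
    [m x * V = chi(x) Q V m x] with a fixed Pauli [Q] and a character [chi] supported
    on the controls met so far. A controlled Pauli therefore merely conjugates the error
    (a constant number of gates), while [C(V)] multiplies it by a controlled [Q^dagger]
    and at most [O(r w_q)] controlled-[Z] gates: [O(r^2 w_q)] gates per block. Keeping
    the controlled Paulis as conjugations, instead of expanding them, is what avoids a
    second factor [w_q].

    A bit flip on the ancilla of a stabilizer leaves behind at most [w_c] Pauli errors
    on data qubits; on the ancilla of a PSC round it leaves at most [l] errors
    [V_i^{+-1}], each of which is a product of boundedly many one- and two-qubit
    Cliffords by symplectic elimination. All small gates are taken to be rotations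
    [(1 + N) / sqrt 2] with [N] a Pauli on at most two qubits and [N^2 = -1]. *)

(** * Operators as a unital algebra over the algebraic numbers *)

HB.instance Definition _ (T : finType) := gen_eqMixin (op T).
HB.instance Definition _ (T : finType) := gen_choiceMixin (op T).

Lemma opP (T : finType) (A B : op T) : (forall x y, A x y = B x y) -> A = B.
Proof. by move=> AB; apply/funext => x; apply/funext => y. Qed.

Section OpAlgebra.
Variable T : finType.
Implicit Types A B C : op T.

Definition zeroop : op T := fun _ _ => 0.
Definition addop A B : op T := fun x y => A x y + B x y.
Definition oppop A : op T := fun x y => - A x y.

Fact addopA : associative addop.
Proof. by move=> A B C; apply: opP => x y; apply: addrA. Qed.
Fact addopC : commutative addop.
Proof. by move=> A B; apply: opP => x y; apply: addrC. Qed.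
Fact add0op : left_id zeroop addop.
Proof. by move=> A; apply: opP => x y; apply: add0r. Qed.
Fact addNop : left_inverse zeroop oppop addop.
Proof. by move=> A; apply: opP => x y; apply: addNr. Qed.

HB.instance Definition _ :=
  GRing.isZmodule.Build (op T) addopA addopC add0op addNop.

Fact mulopA : associative (@mulop T).
Proof.
move=> A B C; apply: opP => x y; rewrite /mulop.
under eq_bigr do rewrite big_distrr /=.
rewrite exchange_big /=; apply: eq_bigr => z _.
by rewrite big_distrl /=; apply: eq_bigr => u _; rewrite mulrA.
Qed.
Fact mul1op : left_id (@idop T) (@mulop T).
Proof.
move=> A; apply: opP => x y; rewrite /mulop /idop (bigD1 x) //= eqxx mul1r.
by rewrite big1 ?addr0 // => z zx; rewrite eq_sym (negPf zx) mul0r.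
Qed.
Fact mulop1 : right_id (@idop T) (@mulop T).
Proof.
move=> A; apply: opP => x y; rewrite /mulop /idop (bigD1 y) //= eqxx mulr1.
by rewrite big1 ?addr0 // => z zy; rewrite (negPf zy) mulr0.
Qed.
Fact mulopDl : left_distributive (@mulop T) addop.
Proof.
move=> A B C; apply: opP => x y; rewrite /mulop /addop -big_split /=.
by apply: eq_bigr => z _; rewrite mulrDl.
Qed.
Fact mulopDr : right_distributive (@mulop T) addop.
Proof.
move=> A B C; apply: opP => x y; rewrite /mulop /addop -big_split /=.
by apply: eq_bigr => z _; rewrite mulrDr.
Qed.
Fact idop_neq0 : @idop T != zeroop.
Proof.
apply/eqP => /(congr1 (fun f : op T => f [ffun=> true] [ffun=> true])).
by rewrite /idop /zeroop eqxx; apply/eqP; rewrite oner_eq0.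
Qed.

HB.instance Definition _ := GRing.Zmodule_isNzRing.Build (op T)
  mulopA mul1op mulop1 mulopDl mulopDr idop_neq0.

Fact scaleopA a b A : scaleop a (scaleop b A) = scaleop (a * b) A.
Proof. by apply: opP => x y; apply: mulrA. Qed.
Fact scale1op : left_id 1 (@scaleop T).
Proof. by move=> A; apply: opP => x y; apply: mul1r. Qed.
Fact scaleopDr : right_distributive (@scaleop T) +%R.
Proof. by move=> a A B; apply: opP => x y; apply: mulrDr. Qed.
Fact scaleopDl A : {morph (@scaleop T)^~ A : a b / a + b}.
Proof. by move=> a b; apply: opP => x y; apply: mulrDl. Qed.

HB.instance Definition _ := GRing.Zmodule_isLmodule.Build algC (op T)
  scaleopA scale1op scaleopDr scaleopDl.

Fact scaleopAl a A B : scaleop a (mulop A B) = mulop (scaleop a A) B.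
Proof.
apply: opP => x y; rewrite /scaleop /mulop.
by rewrite big_distrr /=; apply: eq_bigr => z _; rewrite mulrA.
Qed.
HB.instance Definition _ := GRing.Lmodule_isLalgebra.Build algC (op T) scaleopAl.

Fact scaleopAr a A B : scaleop a (mulop A B) = mulop A (scaleop a B).
Proof.
apply: opP => x y; rewrite /scaleop /mulop.
by rewrite big_distrr /=; apply: eq_bigr => z _; rewrite mulrCA.
Qed.
HB.instance Definition _ := GRing.Lalgebra_isAlgebra.Build algC (op T) scaleopAr.

Lemma opmE A B x y : (A * B) x y = \sum_z A x z * B z y. Proof. by []. Qed.
Lemma opDE A B x y : (A + B) x y = A x y + B x y. Proof. by []. Qed.
Lemma opNE A x y : (- A) x y = - A x y. Proof. by []. Qed.
Lemma opZE a A x y : (a *: A) x y = a * A x y. Proof. by []. Qed.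
Lemma op1E x y : (1 : op T) x y = (x == y)%:R. Proof. by []. Qed.
Lemma mulopE A B : mulop A B = A * B. Proof. by []. Qed.

Lemma adjM A B : adj (A * B) = adj B * adj A.
Proof.
apply: opP => x y; rewrite /adj !opmE rmorph_sum; apply: eq_bigr => z _.
by rewrite rmorphM mulrC.
Qed.
Lemma adjK A : adj (adj A) = A.
Proof. by apply: opP => x y; rewrite /adj conjCK. Qed.
Lemma adjD A B : adj (A + B) = adj A + adj B.
Proof. by apply: opP => x y; rewrite /adj !opDE rmorphD. Qed.
Lemma adjZ a A : adj (a *: A) = a^* *: adj A.
Proof. by apply: opP => x y; rewrite /adj !opZE rmorphM. Qed.
Lemma adj1 : adj (1 : op T) = 1.
Proof. by apply: opP => x y; rewrite /adj !op1E conjC_nat eq_sym. Qed.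

Lemma unitaryE A : is_unitary A <-> A * adj A = 1 /\ adj A * A = 1.
Proof. by []. Qed.

Lemma unitary_mul A B : is_unitary A -> is_unitary B -> is_unitary (A * B).
Proof.
rewrite !unitaryE adjM => -[A1 A2] [B1 B2]; split.
  by rewrite mulrA -(mulrA A) B1 mulr1.
by rewrite mulrA -(mulrA (adj B)) A2 mulr1.
Qed.

Lemma unitary_adj A : is_unitary A -> is_unitary (adj A).
Proof. by rewrite !unitaryE adjK => -[]. Qed.

Lemma unitary1 : is_unitary (1 : op T).
Proof. by rewrite unitaryE adj1 mulr1. Qed.

Lemma unitary_scale a A : a * a^* = 1 -> is_unitary A -> is_unitary (a *: A).
Proof.
rewrite !unitaryE adjZ => a1 [A1 A2].
by rewrite -!scalerAl -!scalerAr !scalerA A1 A2 [a^* * a]mulrC a1 scale1r.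
Qed.

Lemma circ_cons A gs : circ (A :: gs) = circ gs * A.
Proof.
suff cat B : foldl (fun acc g => mulop g acc) B gs = circ gs * B.
  by rewrite /circ /= cat mulopE mulr1.
elim: gs B => [|C gs IH] B /=; first by rewrite /circ /= mul1r.
by rewrite /circ /= !IH !mulopE mulrA mulr1.
Qed.

Lemma circ_nil : circ [::] = 1 :> op T. Proof. by []. Qed.

Lemma circ_unitary gs : all_prop (@is_unitary T) gs -> is_unitary (circ gs).
Proof.
elim: gs => [_|A gs IH /= [uA /IH ugs]]; first exact: unitary1.
by rewrite circ_cons; apply: unitary_mul.
Qed.

End OpAlgebra.

(** * Signs and fourth roots of unity *)

Definition is_sign (e : algC) : Prop := e = 1 \/ e = -1.

Lemma sign1 : is_sign 1. Proof. by left. Qed.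
Lemma signM e f : is_sign e -> is_sign f -> is_sign (e * f).
Proof. by case=> ->; case=> ->; rewrite ?mul1r ?mulN1r ?opprK; [left|right|right|left]. Qed.
Lemma sign_sq e : is_sign e -> e * e = 1.
Proof. by case=> ->; rewrite ?mul1r ?mulrNN ?mul1r. Qed.
Lemma sign_prod (I : Type) (r : seq I) (F : I -> algC) :
  (forall i, is_sign (F i)) -> is_sign (\prod_(i <- r) F i).
Proof. by move=> sF; elim/big_ind: _ => // *; [apply: sign1 | apply: signM]. Qed.
Lemma sign_bool (b : bool) : is_sign ((-1) ^+ b).
Proof. by case: b; [right; rewrite expr1 | left; rewrite expr0]. Qed.
Lemma sign_scaleK (T : finType) e (A B : op T) :
  is_sign e -> A = e *: B -> B = e *: A.
Proof. by move=> /sign_sq e2 ->; rewrite scalerA e2 scale1r. Qed.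

Lemma sqr_i : 'i * 'i = -1 :> algC. Proof. by rewrite -expr2 sqrCi. Qed.

Lemma root4_conj (c : algC) : c ^+ 4 = 1 -> c * c^* = 1.
Proof.
move=> c4; rewrite -normCK; have c1 : `|c| = 1.
  by apply/eqP; rewrite -(@pexpr_eq1 _ _ 4) // -normrX c4 normr1.
by rewrite c1 expr1n.
Qed.
Lemma root4_conjX (c : algC) : c ^+ 4 = 1 -> c^* ^+ 4 = 1.
Proof. by move=> c4; rewrite -rmorphXn c4 rmorph1. Qed.
Lemma root4_sq (c : algC) : c ^+ 4 = 1 -> is_sign (c * c).
Proof.
move=> c4; have : (c * c == 1) || (c * c == -1).
  by rewrite -eqf_sqr expr1n -expr2 -exprM c4.
by case/orP=> /eqP ->; [left | right].
Qed.
Lemma root4_i : 'i ^+ 4 = 1 :> algC.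
Proof. by rewrite (exprM _ 2 2) sqrCi sqrrN expr1n. Qed.
Lemma root4P (c : algC) : c ^+ 4 = 1 -> [\/ c = 1, c = -1, c = 'i | c = - 'i].
Proof.
move=> /root4_sq; rewrite -expr2 => -[|] /eqP.
  by rewrite sqrf_eq1 => /orP [] /eqP ->; [constructor 1|constructor 2].
by rewrite -sqrCi eqf_sqr => /orP [] /eqP ->; [constructor 3|constructor 4].
Qed.

(** * Multiplication of single-qubit Pauli letters *)

Definition lX : 'I_4 := @Ordinal 4 1 isT.
Definition lY : 'I_4 := @Ordinal 4 2 isT.
Definition lZ : 'I_4 := @Ordinal 4 3 isT.

Variant letter_spec : 'I_4 -> Type :=
  | LetterI : letter_spec ord0 | LetterX : letter_spec lX
  | LetterY : letter_spec lY | LetterZ : letter_spec lZ.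
Lemma letterP a : letter_spec a.
Proof.
case: a => [[|[|[|[|//]]]] p].
- by rewrite (_ : Ordinal p = ord0); [constructor | apply: val_inj].
- by rewrite (_ : Ordinal p = lX); [constructor | apply: val_inj].
- by rewrite (_ : Ordinal p = lY); [constructor | apply: val_inj].
- by rewrite (_ : Ordinal p = lZ); [constructor | apply: val_inj].
Qed.

(** The Klein four-group of Paulis modulo phase; the phase of the product is [lphase]. The pattern
    [3, _.+3] is the case of two letters Z. *)
Definition lmul (a b : 'I_4) : 'I_4 :=
  match val a, val b with
  | 0, _ => b | _, 0 => a
  | 1, 1 | 2, 2 | 3, _.+3 => ord0
  | 1, 2 | 2, 1 => lZ | 1, _ | _, 1 => lY | _, _ => lX
  end.
Definition lphase (a b : 'I_4) : algC :=
  match val a, val b with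
  | 1, 2 | 2, 3 | 3, 1 => 'i
  | 2, 1 | 3, 2 | 1, 3 => - 'i
  | _, _ => 1
  end.
Definition lanti (a b : 'I_4) : bool := [&& a != ord0, b != ord0 & a != b].

Lemma sigmaM a b x y :
  \sum_z sigma a x z * sigma b z y = lphase a b * sigma (lmul a b) x y.
Proof.
rewrite big_bool /=.
by case: (letterP a); case: (letterP b); case: x; case: y;
  rewrite /sigma /lphase /= ?(mulr0, mul0r, mulr1, mul1r, addr0, add0r, mulrN,
    mulNr, sqr_i, opprK, mulrN1, mulN1r, opprK).
Qed.
Lemma lphase4 a b : lphase a b ^+ 4 = 1.
Proof.
case: (letterP a); case: (letterP b);
  by rewrite /lphase /= ?expr1n // ?(exprM _ 2 2) ?sqrrN ?sqrCi ?sqrrN ?expr1n.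
Qed.
Lemma lmulC a b : lmul a b = lmul b a.
Proof. by case: (letterP a); case: (letterP b). Qed.
Lemma lmulaa a : lmul a a = ord0.
Proof. by case: (letterP a). Qed.
Lemma lmula0 a : lmul a ord0 = a.
Proof. by apply/val_inj; case: (letterP a). Qed.
Lemma lphaseC a b : lphase a b = (-1) ^+ lanti a b * lphase b a.
Proof.
by case: (letterP a); case: (letterP b);
  rewrite /lanti /lphase /= ?expr0 ?expr1 ?mul1r ?mulN1r ?opprK.
Qed.
Lemma lphase0a a : lphase ord0 a = 1. Proof. by []. Qed.
Lemma lphasea0 a : lphase a ord0 = 1.
Proof. by case: (letterP a). Qed.
Lemma lphaseaa a : lphase a a = 1.
Proof. by case: (letterP a). Qed.
Lemma sigma_conj a x y : (sigma a x y)^* = sigma a y x.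
Proof.
by case: (letterP a); case: x; case: y; rewrite /sigma /=
  ?rmorphN /= ?(conjCi, conjC_nat, conjC1, conjC0) ?opprK.
Qed.

(** * Tensor products of Paulis *)

Section Pauli.
Variable T : finType.
Implicit Types (p q : T -> 'I_4) (P Q : op T).
Notation pt := (@pauli_tensor T).

Lemma ptE c p x y : pt c p x y = c * \prod_q sigma (p q) (x q) (y q).
Proof. by []. Qed.

Lemma pt_ext c p q : p =1 q -> pt c p = pt c q.
Proof. by move=> pq; congr pauli_tensor; apply/funext. Qed.

Definition pphase p q : algC := \prod_t lphase (p t) (q t).
(** The symplectic form of two Pauli strings, written as a sign. *)
Definition psign p q : algC := \prod_t (-1) ^+ lanti (p t) (q t).
Lemma pphase4 p q : pphase p q ^+ 4 = 1.
Proof. by rewrite -prodrXl big1 // => t _; rewrite lphase4. Qed.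
Lemma psignP p q : is_sign (psign p q).
Proof. by apply: sign_prod => t; apply: sign_bool. Qed.
Lemma pphaseC p q : pphase p q = psign p q * pphase q p.
Proof. by rewrite -big_split /=; apply: eq_bigr => t _; apply: lphaseC. Qed.

Lemma ptM c d p q :
  pt c p * pt d q = pt (c * d * pphase p q) (fun t => lmul (p t) (q t)).
Proof.
apply: opP => x y; rewrite opmE; under eq_bigr do rewrite !ptE; rewrite ptE.
under eq_bigr do rewrite mulrACA -big_split /=.
rewrite -big_distrr /= -mulrA; congr (_ * _); rewrite -big_split /=.
(* Distributivity turns the sum over intermediate basis states into a product of one-qubit sums. *)
have := bigA_distr_bigA (fun t z => sigma (p t) (x t) z * sigma (q t) z (y t)).
move=> /= <-; apply: eq_bigr => t _; exact: sigmaM.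
Qed.
Lemma ptZ a c p : a *: pt c p = pt (a * c) p.
Proof. by apply: opP => x y; rewrite opZE !ptE mulrA. Qed.
Lemma pt_adj c p : adj (pt c p) = pt c^* p.
Proof.
apply: opP => x y; rewrite /adj !ptE rmorphM rmorph_prod.
by congr (_ * _); apply: eq_bigr => t _; rewrite /= sigma_conj.
Qed.
Lemma pt1 : pt 1 (fun=> ord0) = 1.
Proof.
apply: opP => x y; rewrite op1E ptE mul1r /sigma /=.
have [->|xy] := eqVneq x y; first by rewrite big1 // => t _; rewrite eqxx.
have [t xyt] : exists t, x t != y t.
  apply/existsP; apply: contraR xy; rewrite negb_exists => /forallP e.
  by apply/eqP/ffunP => t; apply/eqP; have := e t; rewrite negbK.
by rewrite (bigD1 t) //= (negPf xyt) mul0r.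
Qed.
Lemma pt_comm c d p q : pt c p * pt d q = psign p q *: (pt d q * pt c p).
Proof.
rewrite !ptM ptZ pphaseC; rewrite mulrCA (mulrC c d).
by apply: pt_ext => t; apply: lmulC.
Qed.
Lemma pt_sq c p : pt c p * pt c p = (c * c) *: 1.
Proof.
rewrite ptM -pt1 ptZ mulr1 /pphase big1 ?mulr1 => [|t _]; last exact: lphaseaa.
by apply: pt_ext => t; apply: lmulaa.
Qed.

Lemma pauliM P Q : is_pauli P -> is_pauli Q -> is_pauli (P * Q).
Proof.
move=> [c [p [c4 ->]]] [d [q [d4 ->]]]; rewrite ptM.
by do 2!eexists; split; last reflexivity; rewrite !exprMn c4 d4 pphase4 !mul1r.
Qed.
Lemma pauli1 : is_pauli (1 : op T).
Proof. by exists 1, (fun=> ord0); rewrite expr1n pt1. Qed.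
Lemma pauli_adj P : is_pauli P -> is_pauli (adj P).
Proof.
move=> [c [p [c4 ->]]]; rewrite pt_adj; exists c^*, p; split=> //.
exact: root4_conjX.
Qed.
Lemma pauliZ a P : a ^+ 4 = 1 -> is_pauli P -> is_pauli (a *: P).
Proof.
move=> a4 [c [p [c4 ->]]]; rewrite ptZ; exists (a * c), p; split=> //.
by rewrite exprMn a4 c4 mulr1.
Qed.
Lemma pauli_unitary P : is_pauli P -> is_unitary P.
Proof.
move=> [c [p [c4 ->]]]; have -> : pt c p = c *: pt 1 p by rewrite ptZ mulr1.
apply: unitary_scale; first exact: root4_conj.
by rewrite unitaryE pt_adj rmorph1 pt_sq mulr1 scale1r.
Qed.
Lemma pauli_comm P Q : is_pauli P -> is_pauli Q ->
  exists2 e, is_sign e & P * Q = e *: (Q * P).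
Proof.
move=> [c [p [c4 ->]]] [d [q [d4 ->]]].
by exists (psign p q); [apply: psignP | apply: pt_comm].
Qed.
Lemma pauli_sq P : is_pauli P -> exists2 e, is_sign e & P * P = e *: 1.
Proof.
move=> [c [p [c4 ->]]]; exists (c * c); last exact: pt_sq.
exact: root4_sq.
Qed.

Definition site (a : T) (e : 'I_4) : T -> 'I_4 := fun t => if t == a then e else ord0.
Definition sitep (a : T) (e : 'I_4) : op T := pt 1 (site a e).

Lemma sitep_pauli a e : is_pauli (sitep a e).
Proof. by exists 1, (site a e); rewrite expr1n. Qed.
Lemma sitepE a e x y :
  sitep a e x y = sigma e (x a) (y a) * [forall t, (t != a) ==> (x t == y t)]%:R.
Proof.
rewrite /sitep ptE mul1r (bigD1 a) //= /site eqxx; congr (_ * _).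
case: forallP => [xy|xy].
  rewrite big1 // => t ta; rewrite (negPf ta) /sigma /=.
  by have := xy t; rewrite ta /= => ->.
have [t ta] : exists t, ~~ ((t != a) ==> (x t == y t)).
  by apply/existsP; rewrite -negb_forall; apply/forallP.
rewrite (bigD1 t) /=; last by case: (t != a) ta.
by move: ta; rewrite negb_imply => /andP [ta xyt]; rewrite (negPf ta) /sigma /= (negPf xyt) mul0r.
Qed.
Lemma sitep_adj a e : adj (sitep a e) = sitep a e.
Proof. by rewrite pt_adj rmorph1. Qed.
Lemma sitep_sq a e : sitep a e * sitep a e = 1.
Proof. by rewrite pt_sq mul1r scale1r. Qed.

Lemma sitepZE a x y : sitep a lZ x y = (-1) ^+ x a * (x == y)%:R.
Proof.
rewrite sitepE; have [->|xy] := eqVneq x y.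
  have -> : [forall t, (t != a) ==> (y t == y t)].
    by apply/forallP => t; rewrite eqxx implybT.
  by rewrite !mulr1 /sigma /= eqxx; case: (y a); rewrite ?expr0 ?expr1.
rewrite mulr0 /sigma /=; case: (eqVneq (x a) (y a)) => [xya|_]; last by rewrite mul0r.
case: forallP => [e|_]; last by rewrite mulr0.
case/negP: xy; apply/eqP/ffunP => t; apply/eqP; have := e t.
by case: (eqVneq t a) => [->|//]; rewrite xya eqxx.
Qed.

Lemma sitepZ_mull (A : op T) a x y : (sitep a lZ * A) x y = (-1) ^+ x a * A x y.
Proof.
rewrite opmE (bigD1 x) //= sitepZE eqxx mulr1 big1 ?addr0 // => z zx.
by rewrite sitepZE eq_sym (negPf zx) mulr0 mul0r.
Qed.
Lemma sitepZ_mulr (A : op T) a x y : (A * sitep a lZ) x y = A x y * (-1) ^+ y a.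
Proof.
rewrite opmE (bigD1 y) //= sitepZE eqxx mulr1 big1 ?addr0 // => z zx.
by rewrite sitepZE (negPf zx) !mulr0.
Qed.

(** Peels off one site, for inductions over the qubits on which a Pauli may act. *)
Lemma pt_split c p a :
  pt c p = sitep a (p a) * pt c (fun t => if t == a then ord0 else p t).
Proof.
rewrite ptM mul1r /pphase big1 ?mulr1 => [|t _].
  by apply: pt_ext => t; rewrite /site; case: eqP => [->|]; rewrite ?lmula0.
by rewrite /site; case: eqP => _; rewrite ?lphase0a ?lphasea0.
Qed.

(** The Paulis act irreducibly: commuting with every Z kills the off-diagonal entries, and commuting
    with the bit flips makes the diagonal constant. *)
Lemma commuting_pauli_scalar (U : op T) :
  (forall p, U * pt 1 p = pt 1 p * U) -> exists c, U = c *: 1.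
Proof.
move=> UP; exists (U [ffun=> false] [ffun=> false]).
have flipE (x y u : basis T) :
    pt 1 (fun t => if u t then lX else ord0) x y = (y == [ffun t => x t (+) u t])%:R.
  rewrite ptE mul1r; case: eqP => [->|xy].
    by apply: big1 => t _; rewrite ffunE; case: (u t); case: (x t).
  have [t xyt] : exists t, y t != x t (+) u t.
    apply/existsP; apply: contra_notT xy; rewrite negb_exists => /forallP e.
    by apply/ffunP => t; rewrite ffunE; apply/eqP; have := e t; rewrite negbK.
  rewrite (bigD1 t) //=; move: xyt.
  by case: (u t); case: (x t); case: (y t); rewrite /sigma //= mul0r.
apply: opP => x y; rewrite opZE op1E; have [<-|xy] := eqVneq x y; last first.
  have [t xyt] : exists t, x t != y t.
    apply/existsP; apply: contraR xy; rewrite negb_exists => /forallP e.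
    by apply/eqP/ffunP => t; apply/eqP; have := e t; rewrite negbK.
  (* A Z at a qubit where [x] and [y] differ gives [U x y = - U x y]. *)
  have /(congr1 (fun A : op T => A x y)) := UP (site t lZ).
  rewrite -/(sitep t lZ) sitepZ_mulr sitepZ_mull mulr0; move: xyt.
  case: (x t); case: (y t) => // _; rewrite ?expr0 ?expr1 ?mulr1 ?mul1r ?mulN1r ?mulrN1 => /eqP;
  by rewrite ?[- U x y == _]eq_sym -addr_eq0 -mulr2n mulrn_eq0 => /eqP.
(* The bit flip exchanging the all-false state and [x] equates their diagonal entries. *)
have /(congr1 (fun A : op T => A [ffun=> false] x)) := UP (fun t => if x t then lX else ord0).
rewrite !opmE (bigD1 [ffun=> false]) //= big1 => [|z z0]; last first.
  rewrite flipE; case: eqP => [e|]; rewrite ?mulr0 //; case/negP: z0.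
  apply/eqP/ffunP => t; move/ffunP/(_ t): e; rewrite !ffunE.
  by case: (x t); case: (z t).
rewrite (bigD1 x) //= big1 => [|z zx]; last first.
  rewrite flipE; case: eqP => [e|]; rewrite ?mul0r //; case/negP: zx.
  by rewrite e; apply/eqP/ffunP => t; rewrite !ffunE.
rewrite !flipE !addr0.
have -> : x == [ffun t => [ffun=> false] t (+) x t].
  by apply/eqP/ffunP => t; rewrite !ffunE.
by rewrite mul1r !mulr1.
Qed.

End Pauli.

(** * Operators on a block, selected by the basis state of the other qubits *)

Section Mux.
Variables (S T : finType) (g : S -> T).
Hypothesis g_inj : injective g.
Implicit Types (x y z : basis T) (u : basis S).

Definition restr (x : basis T) : basis S := [ffun s => x (g s)].
Definition outeq (x y : basis T) : bool :=
  [forall t, (t \notin codom g) ==> (x t == y t)].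
Definition glue (u : basis S) (x : basis T) : basis T :=
  [ffun t => if [pick s | g s == t] is Some s then u s else x t].

(* The operator that applies [m x] to the qubits in the image of [g], where [x]
   is the basis state of the remaining qubits. *)
Definition mux (m : basis T -> op S) : op T :=
  fun x y => m x (restr x) (restr y) * (outeq x y)%:R.
Definition indep (A : Type) (m : basis T -> A) : Prop :=
  forall x y, outeq x y -> m x = m y.

Lemma muxE m x y : mux m x y = m x (restr x) (restr y) * (outeq x y)%:R.
Proof. by []. Qed.
Lemma embedE G : embed g G = mux (fun=> G). Proof. by []. Qed.

Lemma outeqP x y : reflect (forall t, t \notin codom g -> x t = y t) (outeq x y).
Proof.
apply: (iffP forallP) => [e t tg|e t]; last by apply/implyP => /e ->.
by have := e t; rewrite tg => /eqP.
Qed.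
Lemma outeq_sym x y : outeq x y = outeq y x.
Proof. by apply/outeqP/outeqP => e t /e. Qed.
Lemma outeqxx x : outeq x x. Proof. exact/outeqP. Qed.
Lemma outeq_trans x y z : outeq x y -> outeq x z = outeq y z.
Proof.
move=> /outeqP xy; apply/outeqP/outeqP => e t tg; first by rewrite -xy ?e.
by rewrite xy ?e.
Qed.

Lemma glue_in u x s : glue u x (g s) = u s.
Proof.
rewrite ffunE; case: pickP => [s' /eqP/g_inj -> //|/(_ s)].
by rewrite eqxx.
Qed.
Lemma glue_out u x t : t \notin codom g -> glue u x t = x t.
Proof.
rewrite ffunE; case: pickP => // s /eqP <-.
by rewrite codom_f.
Qed.
Lemma restr_glue u x : restr (glue u x) = u.
Proof. by apply/ffunP => s; rewrite ffunE glue_in. Qed.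
Lemma outeq_glue u x : outeq x (glue u x).
Proof. by apply/outeqP => t tg; rewrite glue_out. Qed.
Lemma glue_restr x z : outeq x z -> glue (restr z) x = z.
Proof.
move=> /outeqP xz; apply/ffunP => t; have [/codomP [s ->]|tg] := boolP (t \in codom g).
  by rewrite glue_in ffunE.
by rewrite glue_out ?xz.
Qed.
Lemma eq_restr_out x y : (restr x == restr y) && outeq x y = (x == y).
Proof.
apply/andP/eqP => [[/eqP r o]|->]; last by rewrite eqxx outeqxx.
by rewrite -(glue_restr o) -r glue_restr ?outeqxx.
Qed.

(** States agreeing with [x] outside the block are parametrised by their restriction to it; this
    reduces products of operators on [T] to products on [S]. *)
Lemma sum_outeq (x : basis T) (F : basis T -> algC) :
  \sum_z F z * (outeq x z)%:R = \sum_u F (glue u x).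
Proof.
rewrite (bigID (outeq x)) /= [X in _ + X]big1 ?addr0; last first.
  by move=> z /negPf ->; rewrite mulr0.
rewrite (reindex_onto (glue^~ x) restr) /=; last by move=> z /glue_restr.
apply: eq_big => [u|u _]; last by rewrite outeq_glue mulr1.
by rewrite outeq_glue restr_glue eqxx.
Qed.

(** The right factor is evaluated at the intermediate basis state, which agrees with [x] outside the
    block, so [indep m'] allows its evaluation at [x]. *)
Lemma muxM m m' : indep m' -> mux m * mux m' = mux (fun x => m x * m' x).
Proof.
move=> im'; apply: opP => x y; rewrite opmE muxE opmE mulr_suml.
under eq_bigr do rewrite !muxE mulrAC.
rewrite sum_outeq; apply: eq_bigr => u _.
rewrite restr_glue -(im' _ _ (outeq_glue u x)) -(outeq_trans _ (outeq_glue u x)).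
by rewrite mulrA.
Qed.
Lemma mux_adj m : indep m -> adj (mux m) = mux (fun x => adj (m x)).
Proof.
move=> im; apply: opP => x y; rewrite /adj !muxE rmorphM /= conjC_nat outeq_sym.
by case: (boolP (outeq x y)) => [/im ->|_] //; rewrite !mulr0.
Qed.
Lemma muxD m m' : mux (fun x => m x + m' x) = mux m + mux m'.
Proof. by apply: opP => x y; rewrite opDE !muxE opDE mulrDl. Qed.
Lemma muxN m : mux (fun x => - m x) = - mux m.
Proof. by apply: opP => x y; rewrite opNE !muxE opNE mulNr. Qed.
Lemma muxZ a m : mux (fun x => a *: m x) = a *: mux m.
Proof. by apply: opP => x y; rewrite opZE !muxE opZE mulrA. Qed.
Lemma mux1 : mux (fun=> 1) = 1.
Proof. by apply: opP => x y; rewrite muxE !op1E -natrM mulnb eq_restr_out. Qed.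
Lemma eq_mux m m' : m =1 m' -> mux m = mux m'.
Proof. by move=> e; congr mux; apply/funext. Qed.
Lemma mux_z t : t \notin codom g -> sitep t lZ = mux (fun x => (-1) ^+ x t *: 1).
Proof.
move=> tg; apply: opP => x y; rewrite sitepZE muxE opZE op1E -mulrA.
by rewrite -natrM mulnb eq_restr_out.
Qed.
Lemma ctrl_mux c (G : op S) : c \notin codom g ->
  ctrl c g G = mux (fun x => if x c then G else 1).
Proof.
move=> cg; apply: opP => x y; rewrite /ctrl embedE !muxE.
have [o|no] := boolP (outeq x y); last first.
  rewrite !mulr0; case: ifP => // _; case: ifP => // _.
  by rewrite -eq_restr_out (negPf no) andbF.
have := elimT (outeqP x y) o c cg => <-; case: (x c) => //=.
by rewrite op1E -eq_restr_out o andbT mulr1.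
Qed.

Lemma embedM A B : embed g (A * B) = embed g A * embed g B.
Proof. by rewrite !embedE muxM. Qed.
Lemma embedD A B : embed g (A + B) = embed g A + embed g B.
Proof. by rewrite !embedE muxD. Qed.
Lemma embedZ a A : embed g (a *: A) = a *: embed g A.
Proof. by rewrite !embedE muxZ. Qed.
Lemma embed1 : embed g 1 = 1.
Proof. by rewrite embedE mux1. Qed.
Lemma embed_pauli c p : (forall t, t \notin codom g -> p t = ord0) ->
  pauli_tensor c p = embed g (pauli_tensor c (fun s => p (g s))).
Proof.
move=> p0; apply: opP => x y; rewrite embedE muxE !ptE -mulrA; congr (_ * _).
rewrite (bigID (mem (codom g))) /=; congr (_ * _).
  rewrite (reindex_omap (fun s => g s) (fun t => [pick s | g s == t])) /=; last first.
    move=> t /codomP [s ->]; case: pickP => [s' /eqP e|/(_ s)]; first by rewrite /= e.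
    by rewrite eqxx.
  apply: eq_big => s.
    rewrite codom_f /=; case: pickP => [s' /eqP/g_inj -> |/(_ s)]; rewrite eqxx //.
  by rewrite !ffunE.
case: (boolP (outeq x y)) => [/outeqP xy|].
  by rewrite big1 // => t tg; rewrite (p0 _ tg) xy // /sigma eqxx.
rewrite negb_forall => /existsP [t]; rewrite negb_imply => /andP [tg xyt].
by rewrite (bigD1 t) //= (p0 _ tg) /sigma /= (negPf xyt) mul0r.
Qed.

End Mux.

(** The factor [outeq g'] forces the intermediate state to agree with [y] outside the image of [g'],
    hence on the image of [g]: one term of the sum survives. *)
Lemma sum_glue_out (S S' T : finType) (g : S -> T) (g' : S' -> T) x y
    (F : basis S -> algC) : injective g -> (forall s, g s \notin codom g') ->
  \sum_u F u * (outeq g' (glue g u x) y)%:R =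
  F (restr g y) * (outeq g' (glue g (restr g y) x) y)%:R.
Proof.
move=> gi out; rewrite (bigD1 (restr g y)) //= big1 ?addr0 // => u uy.
case: outeqP => [e|_]; rewrite ?mulr0 //; case/eqP: uy.
by apply/ffunP => s; rewrite ffunE -(glue_in gi u x s) e.
Qed.

(** In either order only one intermediate state contributes, and the entries agree because the
    supports are disjoint and [m] does not see the qubits of [g']. *)
Lemma mux_embedC (S S' T : finType) (g : S -> T) (g' : S' -> T)
    (m : basis T -> op S) (A : op S') :
  injective g -> injective g' ->
  (forall s s', g s != g' s') -> indep g' m ->
  mux g m * embed g' A = embed g' A * mux g m.
Proof.
move=> gi gi' dis im; apply: opP => x y; rewrite !opmE embedE.
under eq_bigr do rewrite !muxE mulrAC; rewrite sum_outeq //.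
under [RHS]eq_bigr do rewrite !muxE mulrAC; rewrite sum_outeq //.
have out s : g s \notin codom g' by apply/codomP => -[s' /eqP]; rewrite (negPf (dis _ _)).
have out' s : g' s \notin codom g by apply/codomP => -[s' /esym/eqP]; rewrite (negPf (dis _ _)).
under eq_bigr do rewrite mulrA; rewrite sum_glue_out //.
under [RHS]eq_bigr do rewrite mulrA; rewrite sum_glue_out //.
rewrite !restr_glue //.
have -> : restr g' (glue g (restr g y) x) = restr g' x.
  by apply/ffunP => s; rewrite !ffunE -/(glue _ _ _ _) /=; case: pickP => // s' /eqP e; have := dis s' s; rewrite e eqxx.
have -> : restr g (glue g' (restr g' y) x) = restr g x.
  by apply/ffunP => s; rewrite !ffunE; case: pickP => // s' /eqP e; have := dis s s'; rewrite e eqxx.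
rewrite -(im x (glue g' (restr g' y) x)) ?outeq_glue //.
(* Either condition says that [x] and [y] agree outside both supports. *)
have -> : outeq g' (glue g (restr g y) x) y = outeq g (glue g' (restr g' y) x) y.
  apply/outeqP/outeqP => e t tg.
    have [/codomP [s ->]|tg'] := boolP (t \in codom g'); first by rewrite glue_in // ffunE.
    by rewrite glue_out // -e // glue_out.
  have [/codomP [s ->]|tg'] := boolP (t \in codom g); first by rewrite glue_in // ffunE.
  by rewrite glue_out // -e // glue_out.
by rewrite -!mulrA; do 2!(rewrite mulrCA; congr (_ * _)); rewrite mulrC.
Qed.

(** * Clifford rotations and circuits of them *)

Section Rotation.
Variable T : finType.
Implicit Types N P U V A B : op T.

(** For [N * N = -1] this is the exponential of pi N / 4. *)
Definition rot N : op T := (sqrtC 2)^-1 *: (1 + N).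

Lemma sqrtC2V_sq : (sqrtC 2)^-1 * (sqrtC 2)^-1 = 2^-1 :> algC.
Proof. by rewrite -invfM -expr2 sqrtCK. Qed.
Lemma sqrtC2V_conj : ((sqrtC 2)^-1)^* = (sqrtC 2)^-1 :> algC.
Proof. by rewrite fmorphV /= (@conj_Creal _ (sqrtC 2)) // ger0_real // sqrtC_ge0 ler0n. Qed.

Lemma half_double A : 2^-1 *: (A + A) = A.
Proof. by rewrite -mulr2n -scaler_nat scalerA mulVf ?scale1r // pnatr_eq0. Qed.

Lemma rot_adj N : adj N = - N -> adj (rot N) = rot (- N).
Proof. by move=> aN; rewrite /rot adjZ adjD adj1 aN sqrtC2V_conj. Qed.

Lemma rotM N N' : rot N * rot N' = 2^-1 *: ((1 + N) * (1 + N')).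
Proof. by rewrite /rot -scalerAl -scalerAr scalerA sqrtC2V_sq. Qed.
Lemma rotNK N : N * N = -1 -> rot N * rot (- N) = 1.
Proof.
move=> NN; rewrite rotM mulrDl mul1r mulrDr mulr1 mulrN NN opprK.
by rewrite addrA subrK half_double.
Qed.
Lemma rot_conj N P : rot N * P * rot (- N) = 2^-1 *: ((1 + N) * P * (1 - N)).
Proof. by rewrite /rot -!scalerAl -!scalerAr !scalerA sqrtC2V_sq. Qed.
Lemma rot_commute N P : N * P = P * N -> rot N * P = P * rot N.
Proof. by move=> NP; rewrite /rot -scalerAl -scalerAr mulrDl mulrDr mul1r mulr1 NP. Qed.
Lemma rot_conj_comm N P : N * N = -1 -> N * P = P * N ->
  rot N * P * rot (- N) = P.
Proof.
by move=> NN /rot_commute ->; rewrite -mulrA rotNK ?mulr1.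
Qed.
(** Moving [P] to the right turns [1 - N] into [1 + N], and the square of [1 + N] is twice [N]. *)
Lemma rot_conj_anti N P : N * N = -1 -> N * P = - (P * N) ->
  rot N * P * rot (- N) = N * P.
Proof.
move=> NN NP; rewrite rot_conj mulrDl mul1r NP mulrBr mulr1 mulrBl -mulrA NN.
by rewrite mulrN1 opprK opprD [- (P * N) - P]addrC addrACA subrr add0r -opprD scalerN half_double.
Qed.

Lemma sqN1_root4 (c : algC) : c * c = -1 -> c ^+ 4 = 1.
Proof. by move=> cc; rewrite (exprM c 2 2) [c ^+ 2]expr2 cc sqrrN expr1n. Qed.

Lemma pauli_anti_adj c (p : T -> 'I_4) : c * c = -1 ->
  adj (pauli_tensor c p) = - pauli_tensor c p.
Proof.
move=> cc; rewrite pt_adj -scaleN1r ptZ mulN1r; congr pauli_tensor.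
have c4 : c ^+ 4 = 1 by exact: sqN1_root4.
have c0 : c != 0 by apply: contra_eq_neq c4 => ->; rewrite expr0n eq_sym oner_eq0.
by apply: (mulfI c0); rewrite root4_conj // mulrN cc opprK.
Qed.

Lemma pauli_anti_sq c (p : T -> 'I_4) : c * c = -1 ->
  pauli_tensor c p * pauli_tensor c p = -1.
Proof. by move=> cc; rewrite pt_sq cc scaleN1r. Qed.

(** Every Pauli commutes or anticommutes with [N], so conjugation either fixes it or multiplies it
    by [N]. *)
Lemma rot_clifford c (p : T -> 'I_4) : c * c = -1 ->
  is_clifford (rot (pauli_tensor c p)).
Proof.
set N := pauli_tensor c p => cc.
have NN : N * N = -1 by apply: pauli_anti_sq.
have aR : adj (rot N) = rot (- N) by rewrite rot_adj // pauli_anti_adj.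
have pN : is_pauli N by exists c, p; split=> //; apply: sqN1_root4.
split.
  rewrite unitaryE aR rotNK //; split=> //.
  by rewrite -{2}(opprK N) rotNK // mulrNN.
move=> P pP; rewrite !mulopE aR.
have [e [] -> NP] := pauli_comm pN pP; rewrite ?scale1r ?scaleN1r in NP.
  by rewrite rot_conj_comm.
by rewrite rot_conj_anti //; apply: pauliM.
Qed.

(** Taking [a = b] gives the one-qubit generators. *)
Definition gen2 N : Prop := exists c (p : T -> 'I_4) (a b : T),
  [/\ c * c = -1, N = pauli_tensor c p & forall t, t != a -> t != b -> p t = ord0].

Lemma gen2_adj N : gen2 N -> adj N = - N.
Proof. by move=> [c [p [a [b [cc -> _]]]]]; apply: pauli_anti_adj. Qed.
Lemma gen2_opp N : gen2 N -> gen2 (- N).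
Proof.
move=> [c [p [a [b [cc -> p0]]]]]; exists (- c), p, a, b; split=> //.
  by rewrite mulrNN.
by rewrite -scaleN1r ptZ mulN1r.
Qed.
Lemma gen2_rot_adj N : gen2 N -> adj (rot N) = rot (- N).
Proof. by move=> gN; rewrite rot_adj ?gen2_adj. Qed.
Lemma gen2_unitary N : gen2 N -> is_unitary (rot N).
Proof. by move=> [c [p [a [b [cc -> _]]]]]; case: (rot_clifford p cc). Qed.

(* [U] is a product of at most [n] rotations [rot N] on one or two qubits, up to
   a global phase. *)
Inductive rotcirc : nat -> op T -> Prop :=
| rotcirc_scal n c : c * c^* = 1 -> rotcirc n (c *: 1)
| rotcirc_rot n N U : gen2 N -> rotcirc n U -> rotcirc n.+1 (rot N * U).

Lemma rotcirc_le n m U : (n <= m)%N -> rotcirc n U -> rotcirc m U.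
Proof.
move=> nm rU; elim: rU m nm => [{}n c cc m _|{}n N V gN _ IH [|m]] //.
  exact: rotcirc_scal.
by move=> nm; apply: rotcirc_rot => //; apply: IH.
Qed.
Lemma rotcircZ n c U : c * c^* = 1 -> rotcirc n U -> rotcirc n (c *: U).
Proof.
move=> cc; elim=> [{}n d dd|{}n N V gN _ IH].
  by rewrite scalerA; apply: rotcirc_scal; rewrite rmorphM mulrACA cc dd mulr1.
by rewrite scalerAr; apply: rotcirc_rot.
Qed.
Lemma rotcircM n m U V : rotcirc n U -> rotcirc m V -> rotcirc (n + m) (U * V).
Proof.
elim=> [{}n c cc|{}n N U' gN _ IH] rV.
  rewrite -scalerAl mul1r; apply: (@rotcirc_le m); first exact: leq_addl.
  exact: rotcircZ.
by rewrite -mulrA addSn; apply: rotcirc_rot => //; apply: IH.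
Qed.
Lemma rotcirc1 n : rotcirc n 1.
Proof. by rewrite -(scale1r 1); apply: rotcirc_scal; rewrite rmorph1 mulr1. Qed.
Lemma rotcirc_gen N : gen2 N -> rotcirc 1 (rot N).
Proof. by move=> gN; rewrite -[rot N]mulr1; apply: rotcirc_rot => //; apply: rotcirc1. Qed.
Lemma rotcirc_adj n U : rotcirc n U -> rotcirc n (adj U).
Proof.
elim=> [{}n c cc|{}n N V gN _ IH].
  by rewrite adjZ adj1; apply: rotcirc_scal; rewrite conjCK mulrC.
rewrite adjM gen2_rot_adj // -addn1; apply: rotcircM => //.
exact: rotcirc_gen (gen2_opp gN).
Qed.
Lemma rotcirc_unitary n U : rotcirc n U -> is_unitary U.
Proof.
elim=> [{}n c cc|{}n N V gN _ IH]; first by apply: unitary_scale => //; apply: unitary1.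
by apply: unitary_mul => //; apply: gen2_unitary.
Qed.

(** A Pauli [N] with square -1 is the square of [rot N]; one with square 1 is first multiplied by
    ['i], at the price of a phase. *)
Lemma rotcirc_pauli2 c (p : T -> 'I_4) a b : c ^+ 4 = 1 ->
  (forall t, t != a -> t != b -> p t = ord0) -> rotcirc 2 (pauli_tensor c p).
Proof.
move=> c4 p0.
suff r2 d : d * d = -1 -> rotcirc 2 (pauli_tensor d p).
  have [cc|cc] := root4_sq c4; last exact: r2.
  have -> : pauli_tensor c p = - 'i *: pauli_tensor ('i * c) p.
    by rewrite ptZ mulrA mulNr sqr_i opprK mul1r.
  apply: rotcircZ; first by rewrite root4_conj // exprNn root4_i -signr_odd expr0 mul1r.
  by apply: r2; rewrite mulrACA sqr_i cc mulr1.
move=> dd; have gN : gen2 (pauli_tensor d p) by exists d, p, a, b.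
have -> : pauli_tensor d p = rot (pauli_tensor d p) * rot (pauli_tensor d p).
  rewrite rotM mulrDl mul1r mulrDr mulr1 pauli_anti_sq //.
  by rewrite addrC addrA subrK half_double.
by apply: (@rotcircM 1 1); apply: rotcirc_gen.
Qed.

Lemma norm_1Di : (1 + 'i) * (1 - 'i) = 2 :> algC.
Proof. by rewrite mulrDl mul1r mulrBr mulr1 sqr_i opprK addrA subrK. Qed.
Lemma unit_1Di : ((1 + 'i) / sqrtC 2) * ((1 + 'i) / sqrtC 2)^* = 1 :> algC.
Proof.
rewrite rmorphM /= sqrtC2V_conj mulrACA sqrtC2V_sq rmorphD /= conjC1 conjCi.
by rewrite norm_1Di mulfV // pnatr_eq0.
Qed.
Lemma unit_1Bi : ((1 - 'i) / sqrtC 2) * ((1 - 'i) / sqrtC 2)^* = 1 :> algC.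
Proof.
rewrite rmorphM /= sqrtC2V_conj mulrACA sqrtC2V_sq rmorphB /= conjC1 conjCi opprK.
by rewrite mulrC [_ * (1 + 'i)]mulrC norm_1Di mulVf // pnatr_eq0.
Qed.

(** Applies [B] on the -1 eigenspace of an involution [A]: controlled [B] when [A] is the Z of the
    control. *)
Definition czop A B : op T := 2^-1 *: (1 + A) + 2^-1 *: (1 - A) * B.

(** For commuting involutions, [czop A B] is the exponential of i pi (1 - A)(1 - B) / 4, which
    splits into a phase and one rotation for each of [A], [B] and [A * B]. *)
Lemma czop_rot A B : A * A = 1 -> B * B = 1 -> A * B = B * A ->
  czop A B = ((1 + 'i) / sqrtC 2) *:
     (rot (- 'i *: A) * (rot (- 'i *: B) * rot ('i *: (A * B)))).
Proof.
move=> AA BB AB.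
have AAB : A * (A * B) = B by rewrite mulrA AA mul1r.
have BAB : B * (A * B) = A by rewrite AB mulrA BB mul1r.
have ABAB : A * B * (A * B) = 1 by rewrite -mulrA BAB AA.
have expand a b c : (1 + a *: A) * ((1 + b *: B) * (1 + c *: (A * B))) =
    (1 + a * b * c) *: 1 +
    ((a + b * c) *: A + ((b + a * c) *: B + (c + a * b) *: (A * B))).
  have -> x y z : (1 + x) * ((1 + y) * (1 + z)) = 1 + x + (y + x * y) +
      (1 + x + (y + x * y)) * z :> op T.
    by rewrite mulrA mulrDr mulr1 mulrDr mulr1 (mulrDl 1 x y) mul1r.
  rewrite -!scalerAl -!scalerAr !scalerA.
  rewrite !mulrDl mul1r -!scalerAl AAB BAB ABAB.
  rewrite !scalerDr !scalerA !scalerDl !scale1r.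
  rewrite (mulrC c a) (mulrC c b) (mulrC c (a * b)).
  (* Collects the eight terms along [1], [A], [B] and [A * B]. *)
  by rewrite (AC ((2*2)*(2*2)) ((1*8)*((2*7)*((3*6)*(5*4))))).
rewrite /rot -!scalerAl -!scalerAr !scalerA expand.
rewrite mulrNN sqr_i !mulNr sqr_i opprK mul1r [- 'i + 1]addrC.
have -> : 'i - 1 = - (1 - 'i) :> algC by rewrite opprB.
rewrite scaleNr.
rewrite -scalerN -!scalerDr scalerA.
rewrite (_ : _ * (1 - 'i) = 2^-1).
  rewrite /czop -scalerAl -scalerDr mulrDl mul1r mulNr; congr (_ *: _).
  by rewrite -addrA.
rewrite sqrtC2V_sq -[_ / sqrtC 2 / sqrtC 2]mulrA sqrtC2V_sq mulrAC [X in X * _]mulrAC.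
by rewrite norm_1Di mulfV ?mul1r // pnatr_eq0.
Qed.

(** The hypothesis makes the two one-qubit Paulis commute. Equal letters on one qubit are included
    so that a control may occur in its own character. *)
Lemma rotcirc_cz a e b f : a != b \/ e = f -> rotcirc 3 (czop (sitep a e) (sitep b f)).
Proof.
move=> abef; have gA : gen2 (- 'i *: sitep a e).
  exists (- 'i), (site a e), a, a; split; first by rewrite mulrNN sqr_i.
    by rewrite ptZ mulr1.
  by move=> t ta _; rewrite /site (negPf ta).
have gB : gen2 (- 'i *: sitep b f).
  exists (- 'i), (site b f), b, b; split; first by rewrite mulrNN sqr_i.
    by rewrite ptZ mulr1.
  by move=> t tb _; rewrite /site (negPf tb).
have ph : pphase (site a e) (site b f) = 1.
  apply: big1 => t _; rewrite /site; case: (eqVneq t a) => [->|_] //.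
  case: abef => [/negPf ->|->]; first by rewrite lphasea0.
  by case: eqP; rewrite ?lphaseaa ?lphasea0.
have AB : sitep a e * sitep b f = pauli_tensor 1 (fun t => lmul (site a e t) (site b f t)).
  by rewrite ptM ph !mulr1.
have BA : sitep a e * sitep b f = sitep b f * sitep a e.
  rewrite pt_comm; have -> : psign (site a e) (site b f) = 1; last by rewrite scale1r.
  apply: big1 => t _; rewrite /site /lanti; case: (eqVneq t a) => [->|_] //=.
  case: abef => [/negPf ->|->]; first by rewrite eqxx andbF.
  by case: (a == b); rewrite !eqxx ?andbF.
have gAB : gen2 ('i *: (sitep a e * sitep b f)).
  rewrite AB ptZ mulr1; exists 'i, (fun t => lmul (site a e t) (site b f t)), a, b.
  by split; [exact: sqr_i | | move=> t ta tb; rewrite /site (negPf ta) (negPf tb)].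
rewrite czop_rot ?sitep_sq //; apply: rotcircZ; first exact: unit_1Di.
by apply: rotcirc_rot => //; apply: rotcirc_rot => //; apply: rotcirc_gen.
Qed.

(** The operator is diag(1, c) on qubit [a]: the identity, Z, or up to a phase a single rotation
    about Z. *)
Lemma rotcirc_phase a c : c ^+ 4 = 1 ->
  rotcirc 2 (2^-1 *: (1 + sitep a lZ) + (c * 2^-1) *: (1 - sitep a lZ)).
Proof.
have gZ d : d * d = -1 -> gen2 (d *: sitep a lZ).
  exists d, (site a lZ), a, a; split=> //; first by rewrite ptZ mulr1.
  by move=> t ta _; rewrite /site (negPf ta).
have rZ : rotcirc 2 (sitep a lZ).
  by apply: (@rotcirc_pauli2 _ _ a a); rewrite ?expr1n // => t ta _; rewrite /site (negPf ta).
set Z := sitep a lZ in gZ rZ *.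
have quarter d : d * d = -1 -> (1 + d) / sqrtC 2 * ((1 + d) / sqrtC 2)^* = 1 ->
    rotcirc 2 (2^-1 *: (1 + Z) + (d * 2^-1) *: (1 - Z)).
  move=> dd ud; apply: (@rotcirc_le 1) => //.
  have -> : 2^-1 *: (1 + Z) + (d * 2^-1) *: (1 - Z) =
      ((1 + d) / sqrtC 2) *: rot (- d *: Z).
    rewrite /rot scalerA -mulrA sqrtC2V_sq (mulrC d) (mulrC (1 + d)) -!scalerA -scalerDr.
    congr (_ *: _); rewrite !scalerDr scalerA mulrN mulrDl mul1r dd opprB.
    by rewrite !scalerDl !scale1r scalerN scaleNr addrACA.
  by apply: rotcircZ => //; apply: rotcirc_gen; apply: gZ; rewrite mulrNN.
case/root4P => ->.
- rewrite mul1r -scalerDr addrACA subrr addr0 half_double; exact: rotcirc1.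
- by rewrite mulN1r scaleNr -scalerBr opprB addrC addrA subrK half_double.
- by apply: quarter; [apply: sqr_i | apply: unit_1Di].
- by apply: quarter; [rewrite mulrNN sqr_i | apply: unit_1Bi].
Qed.

End Rotation.

Lemma rotcirc_embed (S T : finType) (g : S -> T) n (U : op S) :
  injective g -> rotcirc n U -> rotcirc n (embed g U).
Proof.
move=> gi; elim=> [{}n c cc|{}n N V gN _ IH].
  by rewrite embedZ embed1 //; apply: rotcirc_scal.
rewrite embedM // /rot embedZ embedD embed1 // -/(rot _); apply: rotcirc_rot => //.
case: gN => c [p [a [b [cc -> p0]]]].
pose p' t := if [pick s | g s == t] is Some s then p s else ord0.
exists c, p', (g a), (g b); split=> // [|t ta tb].
  rewrite (@embed_pauli _ _ g gi c p') => [|t tg]; last first.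
    by rewrite /p'; case: pickP => // s /eqP e; case/codomP: tg; exists s.
  congr embed; apply: pt_ext => s; rewrite /p'.
  by case: pickP => [s' /eqP/gi ->|/(_ s)] //; rewrite eqxx.
rewrite /p'; case: pickP => // s /eqP e; apply: p0.
  by apply: contra_neq ta => <-.
by apply: contra_neq tb => <-.
Qed.

(** * From rotations to one- and two-qubit Clifford gates *)

Section SmallGates.
Variable T : finType.

Lemma small_rot (N : op T) : gen2 N -> small_clifford_gate (rot N).
Proof.
move=> [c [p [a [b [cc -> p0]]]]].
suff [k [g [k12 gi p0g]]] : exists (k : nat) (g : 'I_k -> T),
    [/\ k = 1%N \/ k = 2%N, injective g & forall t, t \notin codom g -> p t = ord0].
  exists k, g, (rot (pauli_tensor c (fun s => p (g s)))); split=> //.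
    exact: rot_clifford.
  by rewrite {2}/rot embedZ embedD embed1 // -embed_pauli.
have [ab|ab] := eqVneq a b.
  exists 1%N, (fun=> a); split=> [|s s' _|t tg]; [by left | by rewrite !ord1 |].
  have ta : t != a by apply: contraNneq tg => ->; apply: (codom_f (fun=> a) ord0).
  by apply: p0; rewrite -?ab.
pose g (i : 'I_2) := if i == ord0 then a else b.
exists 2%N, g; split=> [|i j|t tg]; first by right.
  rewrite /g; case: (eqVneq i ord0) => i0; case: (eqVneq j ord0) => j0.
  - by rewrite i0 j0.
  - by move=> e; rewrite e eqxx in ab.
  - by move=> e; rewrite e eqxx in ab.
  - move=> _; apply: val_inj; case: i i0 => [[|[|//]] ?] // _.
    by case: j j0 => [[|[|//]] ?].
apply: p0; apply: contraNneq tg => ->.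
  exact: (codom_f g ord0).
exact: (codom_f g (Ordinal (isT : 1 < 2)%N)).
Qed.

Lemma small_scalar (t : T) c : c * c^* = 1 -> small_clifford_gate (c *: 1 : op T).
Proof.
move=> cc; have inj : injective (fun _ : 'I_1 => t) by move=> i j _; rewrite !ord1.
exists 1%N, (fun=> t), (c *: 1); split=> //; first by left.
  split; first by apply: unitary_scale => //; apply: unitary1.
  move=> P pP; rewrite !mulopE adjZ adj1 -scalerAl mul1r -scalerAl -scalerAr mulr1.
  by rewrite scalerA cc scale1r.
by rewrite embedZ embed1 ?inj.
Qed.

Lemma circ_rcons (gs : seq (op T)) A : circ (rcons gs A) = A * circ gs.
Proof. by rewrite /circ foldl_rcons. Qed.

Lemma all_prop_rcons (A : Type) (Q : A -> Prop) s a :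
  all_prop Q s -> Q a -> all_prop Q (rcons s a).
Proof. by elim: s => [|b s IH] /= => [_|[Qb /IH Qs]] Qa; split=> //; apply: Qs. Qed.

(** The global phase that ends a rotation circuit is one more gate and needs some qubit [t] to act
    on. *)
Lemma rotcirc_small (t : T) n (U : op T) : rotcirc n U ->
  exists gs, [/\ all_prop (@small_clifford_gate T) gs, (size gs <= n.+1)%N & U = circ gs].
Proof.
elim=> [{}n c cc|{}n N V gN _ [gs [sgs ngs ->]]].
  exists [:: c *: 1]; split=> //=; last by rewrite circ_cons circ_nil mul1r.
  by split=> //; apply: small_scalar.
exists (rcons gs (rot N)); rewrite size_rcons circ_rcons; split=> //.
by apply: all_prop_rcons => //; apply: small_rot.
Qed.

End SmallGates.

(** * Decomposition of Cliffords by symplectic elimination *)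

Section CliffordDecomposition.
Variable T : finType.
Implicit Types (p q : T -> 'I_4) (U V G : op T) (F : {set T}).
Notation pt := (@pauli_tensor T).

Lemma scale1_inj (a b : algC) : a *: (1 : op T) = b *: 1 -> a = b.
Proof.
move/(congr1 (fun A : op T => A [ffun=> true] [ffun=> true])).
by rewrite !opZE op1E eqxx !mulr1.
Qed.

Lemma unitary_neq0 U : is_unitary U -> U <> 0.
Proof.
by rewrite unitaryE => -[UU _] U0; move/eqP: UU; rewrite U0 mul0r eq_sym oner_eq0.
Qed.

Lemma eq_opp0 (A : op T) : A = - A -> A = 0.
Proof. by move=> e; rewrite -[A]half_double {2}e subrr scaler0. Qed.

Lemma psign1 p q : (forall t, ~~ lanti (p t) (q t)) -> psign p q = 1.
Proof. by move=> h; apply: big1 => t _; rewrite (negPf (h t)) expr0. Qed.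
Lemma psignN1 p q a : lanti (p a) (q a) ->
  (forall t, t != a -> ~~ lanti (p t) (q t)) -> psign p q = -1.
Proof.
move=> ha h; rewrite /psign (bigD1 a) //= ha expr1 big1 ?mulr1 // => t ta.
by rewrite (negPf (h t ta)) expr0.
Qed.
Lemma pt_commute c d p q : (forall t, ~~ lanti (p t) (q t)) ->
  pt c p * pt d q = pt d q * pt c p.
Proof. by move=> h; rewrite pt_comm psign1 // scale1r. Qed.

Lemma lanti_refl a : lanti a a = false. Proof. by rewrite /lanti eqxx !andbF. Qed.
Lemma lanti0r a : lanti a ord0 = false. Proof. by rewrite /lanti eqxx andbF. Qed.
Lemma lantiC a b : lanti a b = lanti b a.
Proof. by rewrite /lanti [a == b]eq_sym andbCA. Qed.

Definition conj_by G A : op T := G * A * adj G.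

Lemma conj_byM G G' A : conj_by (G * G') A = conj_by G (conj_by G' A).
Proof. by rewrite /conj_by adjM !mulrA. Qed.
Lemma conj_byMr G A B : is_unitary G -> conj_by G (A * B) = conj_by G A * conj_by G B.
Proof.
rewrite unitaryE => -[_ GG]; rewrite /conj_by -!mulrA; congr (_ * (_ * _)).
by rewrite !mulrA GG mul1r.
Qed.
Lemma conj_by_id G A : is_unitary G -> G * A = A * G -> conj_by G A = A.
Proof. by rewrite unitaryE => -[GG _] e; rewrite /conj_by e -mulrA GG mulr1. Qed.
Lemma conj_byP G A : is_unitary G -> conj_by G A = A -> G * A = A * G.
Proof.
rewrite unitaryE => -[_ GG] e; rewrite -{2}e /conj_by -[RHS]mulrA GG mulr1 //.
Qed.

(** The product [N] of the anticommuting Pauli involutions [P'] and [P] squares to -1 and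
    anticommutes with [P], so [rot N] carries [P] to [N * P], which is [P']. Since [p] and [p']
    differ at most at [b1] and [b2], [N] is a generator on two qubits. *)
Lemma pauli_move c c' p p' d b1 b2 : is_sign c -> is_sign c' ->
  lanti (p d) (p' d) -> (forall t, t != d -> ~~ lanti (p t) (p' t)) ->
  (forall t, t != b1 -> t != b2 -> p' t = p t) ->
  exists R, [/\ rotcirc 1 R, conj_by R (pt c p) = pt c' p' &
    forall q, (forall t, ~~ lanti (lmul (p' t) (p t)) (q t)) ->
      R * pt 1 q = pt 1 q * R].
Proof.
move=> sc sc' hd hn hb; set P := pt c p; set P' := pt c' p'.
have PP : P * P = 1 by rewrite pt_sq sign_sq // scale1r.
have PP' : P' * P' = 1 by rewrite pt_sq sign_sq // scale1r.
have anti : P * P' = - (P' * P) by rewrite pt_comm (psignN1 hd hn) scaleN1r.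
set N := P' * P.
have NP : N * P = P' by rewrite /N -mulrA PP mulr1.
have PN : P * N = - P' by rewrite /N mulrA anti mulNr NP.
have NN : N * N = -1 by rewrite {1}/N -mulrA PN mulrN PP'.
have NE : N = pt (c' * c * pphase p' p) (fun t => lmul (p' t) (p t)) by rewrite /N ptM.
have gN : gen2 N.
  exists (c' * c * pphase p' p), (fun t => lmul (p' t) (p t)), b1, b2; split=> //.
    by apply: scale1_inj; rewrite -(pt_sq _ (fun t => lmul (p' t) (p t))) -NE NN scaleN1r.
  by move=> t t1 t2; rewrite hb // lmulaa.
exists (rot N); split; first exact: rotcirc_gen.
  by rewrite /conj_by gen2_rot_adj // rot_conj_anti // PN opprK.
by move=> q hq; apply: rot_commute; rewrite NE pt_commute.
Qed.

(** Each clearing rotation removes one letter away from [a] and toggles the letter at [a] between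
    [u] and [v], which supplies the single anticommuting site. Every rotation used acts at [a] by
    the letter [lmul u v] and otherwise inside [F], whence the last clause. *)
Lemma pauli_eliminate (u v : 'I_4) (a : T) F : lanti u v -> a \in F ->
  forall c p, is_sign c -> (forall t, t \notin F -> p t = ord0) ->
  (p a == u) || (p a == v) ->
  exists G, [/\ rotcirc (#|T|.+2) G, conj_by G (pt c p) = sitep a u &
    forall q, (forall t, t \in F -> t != a -> q t = ord0) ->
      ~~ lanti (lmul u v) (q a) -> G * pt 1 q = pt 1 q * G].
Proof.
move=> uv aF.
(* [k] bounds the sites still to be cleared; the two spare rotations correct the letter and the sign
   at [a]. *)
suff main k c p : is_sign c -> (forall t, t \notin F -> p t = ord0) ->
  (p a == u) || (p a == v) -> (#|[set t | (t != a) && (p t != ord0)]| <= k)%N ->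
  exists G, [/\ rotcirc k.+2 G, conj_by G (pt c p) = sitep a u &
    forall q, (forall t, t \in F -> t != a -> q t = ord0) ->
      ~~ lanti (lmul u v) (q a) -> G * pt 1 q = pt 1 q * G].
  by move=> c p sc pF pa; apply: main => //; apply: max_card.
elim: k c p => [|k IH] c p sc pF pa.
  rewrite leqn0 cards_eq0 => /eqP p0.
  have pE : pt c p = pt c (site a (p a)).
    apply: pt_ext => t; rewrite /site; case: eqVneq => [->//|ta].
    by apply/eqP; have /setP/(_ t) := p0; rewrite !inE ta /= => /negbFE.
  rewrite {}pE; have flip c1 c2 e f : is_sign c1 -> is_sign c2 -> lanti e f ->
    lmul f e = lmul u v ->
    exists R, [/\ rotcirc 1 R, conj_by R (pt c1 (site a e)) = pt c2 (site a f) &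
      forall q, (forall t, t \in F -> t != a -> q t = ord0) ->
        ~~ lanti (lmul u v) (q a) -> R * pt 1 q = pt 1 q * R].
    move=> s1 s2 ef fe; have [||t ta _|R [rR RP RQ]] := @pauli_move c1 c2 (site a e) (site a f) a a a s1 s2.
    - by rewrite /site eqxx.
    - by move=> t ta; rewrite /site (negPf ta).
    - by rewrite /site (negPf ta).
    exists R; split=> // q q0 qa; apply: RQ => t; rewrite /site.
    by case: eqVneq => [->|_] //; rewrite fe.
  case/orP: pa => /eqP ->; last first.
    have [||R [rR RP RQ]] := @flip c 1 v u sc sign1 => //.
      by rewrite lantiC.
    by exists R; split=> //; apply: rotcirc_le rR.
  case: sc => ->.
    exists 1; split; first exact: rotcirc1.
      by rewrite /conj_by adj1 mul1r mulr1.
    by move=> q _ _; rewrite mul1r mulr1.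
  (* The sign is removed by passing to the letter [v] and back. *)
  have [||R [rR RP RQ]] := @flip (-1) 1 u v (or_intror erefl) sign1 => //.
    exact: lmulC.
  have [||R' [rR' RP' RQ']] := @flip 1 1 v u sign1 sign1 => //.
    by rewrite lantiC.
  exists (R' * R); split; first exact: (@rotcircM _ 1 1).
    by rewrite conj_byM RP RP'.
  by move=> q q0 qa; rewrite -mulrA RQ // mulrA RQ' // mulrA.
move=> pk; have [p0|] := set_0Vmem [set t | (t != a) && (p t != ord0)].
  have [|G [rG GP GQ]] := IH c p sc pF pa; first by rewrite p0 cards0.
  by exists G; split=> //; apply: rotcirc_le rG.
case=> b; rewrite inE => /andP [ba pb].
have bF : b \in F by apply: contraR pb => /pF ->.
pose o := if p a == u then v else u.
pose p' t := if t == a then o else if t == b then ord0 else p t.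
have po : lanti (p a) o.
  by rewrite /o; case: eqP pa => [-> _|_ /eqP ->] //; rewrite lantiC.
have opa : lmul o (p a) = lmul u v.
  by rewrite /o; case: eqP pa => [-> _|_ /eqP ->] //; rewrite lmulC.
have [||t ta tb|R [rR RP RQ]] := @pauli_move c c p p' a a b sc sc.
- by rewrite /p' eqxx.
- by move=> t ta; rewrite /p' (negPf ta); case: eqP; rewrite ?lanti0r ?lanti_refl.
- by rewrite /p' (negPf ta) (negPf tb).
have [|||G [rG GP GQ]] := IH c p' sc.
- move=> t tF; rewrite /p'; case: eqVneq => [e|_]; first by rewrite -e (negPf tF) in aF.
  by case: eqP => // _; apply: pF.
- by rewrite /p' eqxx /o; case: ifP; rewrite eqxx ?orbT.
- rewrite -ltnS; apply: leq_trans pk; apply: proper_card.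
  apply/properP; split; last by exists b; rewrite !inE /p' ?ba //= (negPf ba) eqxx.
  apply/subsetP => t; rewrite !inE /p' => /andP [ta]; rewrite (negPf ta) /=.
  by case: (t == b); rewrite ?eqxx.
exists (G * R); split; first by rewrite -[k.+3]addn1; apply: rotcircM.
  by rewrite conj_byM RP GP.
move=> q q0 qa; rewrite -mulrA RQ ?mulrA ?GQ // => t.
rewrite /p'; case: (eqVneq t a) => [->|ta]; first by rewrite opa.
case: (eqVneq t b) => [->|_]; first by rewrite q0 ?lanti0r.
by rewrite lmulaa.
Qed.

Lemma clifford_mul U V : is_clifford U -> is_clifford V -> is_clifford (U * V).
Proof.
move=> [uU cU] [uV cV]; split; first exact: unitary_mul.
by move=> P /cV /cU; rewrite !mulopE adjM !mulrA.
Qed.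
Lemma rotcirc_clifford n U : rotcirc n U -> is_clifford U.
Proof.
elim=> [{}n c cc|{}n N V gN _ IH].
  split; first by apply: unitary_scale => //; apply: unitary1.
  move=> P pP; rewrite !mulopE adjZ adj1 -scalerAl mul1r -scalerAl -scalerAr mulr1.
  by rewrite scalerA cc scale1r.
by apply: clifford_mul => //; case: gN => c [p [a [b [cc -> _]]]]; apply: rot_clifford.
Qed.

Lemma lanti_ex e : e != ord0 -> exists f, lanti e f.
Proof. by case: (letterP e) => // _; [exists lY | exists lX | exists lX]. Qed.

(** The image squares to 1, so its coefficient is a sign. Outside [F] every Pauli commutes with [U]
    and with the letter at [a], hence with the image, whose letters there must be trivial. *)
Lemma conj_sitep U F a e : is_clifford U -> a \in F ->
  (forall q, (forall t, t \in F -> q t = ord0) -> U * pt 1 q = pt 1 q * U) ->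
  exists c p, [/\ is_sign c, conj_by U (sitep a e) = pt c p &
    forall t, t \notin F -> p t = ord0].
Proof.
move=> [uU cU] aF UF; have [c [p [c4 E]]] := cU _ (sitep_pauli a e).
rewrite !mulopE -/(conj_by U _) in E; exists c, p; split=> // [|t tF].
  have /scale1_inj/eqP : (c * c) *: (1 : op T) = 1 *: 1.
    rewrite -(pt_sq c p) -E -conj_byMr // sitep_sq /conj_by mulr1 scale1r.
    by case/unitaryE: uU.
  by rewrite -expr2 sqrf_eq1 => /orP [] /eqP; [left | right].
apply/eqP/negPn/negP => /lanti_ex [f pf].
have ta : t != a by apply: contraNneq tF => ->.
have UQ : U * sitep t f = sitep t f * U.
  by apply: UF => s sF; rewrite /site; case: eqVneq => // st; rewrite -st sF in tF.
have comm : pt c p * sitep t f = sitep t f * pt c p.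
  rewrite -E -{1 2}(conj_by_id uU UQ) -!conj_byMr //; congr conj_by.
  apply: pt_commute => s; rewrite /site; case: (eqVneq s a) => // ->.
  by rewrite eq_sym (negPf ta) lanti0r.
have uPQ : is_unitary (pt c p * sitep t f).
  by apply: unitary_mul; apply: pauli_unitary; [exists c, p | apply: sitep_pauli].
apply: (unitary_neq0 uPQ); apply: eq_opp0; rewrite {2}comm.
rewrite pt_comm (@psignN1 _ _ t) ?scaleN1r //; rewrite /site ?eqxx // => s st.
by rewrite (negPf st) lanti0r.
Qed.

(** [F] holds the qubits on which [U] may still act. Two eliminations make [U] commute with all
    Paulis at a qubit [a] of [F], which is then removed; once [F] is empty, [U] is scalar. One qubit
    costs [#|T| + 3] and [#|T| + 2] rotations. *)
Lemma clifford_rotcirc_aux n F U : (#|F| <= n)%N -> is_clifford U ->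
  (forall q, (forall t, t \in F -> q t = ord0) -> U * pt 1 q = pt 1 q * U) ->
  rotcirc (n * (2 * #|T| + 5)) U.
Proof.
elim: n F U => [|n IH] F U.
  rewrite leqn0 cards_eq0 => /eqP -> [uU _] UF.
  have [q|c Uc] := @commuting_pauli_scalar T U; first by apply: UF => t; rewrite inE.
  rewrite Uc; apply: rotcirc_scal; apply: scale1_inj.
  move: uU; rewrite unitaryE Uc => -[]; rewrite adjZ adj1 -scalerAl mul1r scalerA.
  by rewrite scale1r.
move=> Fn cU UF; have [F0|[a aF]] := set_0Vmem F.
  by apply: rotcirc_le (IH F U _ cU UF); rewrite ?F0 ?cards0 // leq_mul2r leqnSn orbT.
have [c [p [sc E pF]]] := conj_sitep lX cU aF UF.
have uU := cU.1.
(* [G1] takes the image of X at [a] back to X at [a]; the additional rotation serves the case of a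
   trivial letter at [a]. *)
have [G1 [rG1 G1P G1Q]] : exists G, [/\ rotcirc (#|T|.+3) G,
    conj_by G (pt c p) = sitep a lX &
    forall q, (forall t, t \in F -> q t = ord0) -> G * pt 1 q = pt 1 q * G].
  have start c' p' : is_sign c' -> (forall t, t \notin F -> p' t = ord0) -> p' a != ord0 ->
    exists G, [/\ rotcirc (#|T|.+2) G, conj_by G (pt c' p') = sitep a lX &
      forall q, (forall t, t \in F -> q t = ord0) -> G * pt 1 q = pt 1 q * G].
    move=> sc' pF' pa'; pose v := if p' a == lX then lZ else p' a.
    have [||G [rG GP GQ]] := @pauli_eliminate lX v a F _ aF c' p' sc' pF'.
    - by rewrite /v; case: ifP => // /negbT n1; rewrite /lanti /= pa' eq_sym n1.
    - by rewrite /v; case: ifP => // _; rewrite eqxx orbT.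
    by exists G; split=> // q q0; apply: GQ => [t tF _|]; rewrite q0 ?lanti0r.
  have [pa|pa] := eqVneq (p a) ord0; last first.
    by have [G [rG GP GQ]] := start c p sc pF pa; exists G; split=> //; apply: rotcirc_le rG.
  (* A scalar image would make X at [a] scalar, although it anticommutes with Z. *)
  have [b pb] : exists b, p b != ord0.
    case: (pickP (fun b => p b != ord0)) => [b pb|p0]; [by exists b | exfalso].
    have Ec : conj_by U (sitep a lX) = c *: 1.
      by rewrite E -pt1 ptZ mulr1; apply: pt_ext => t; apply/eqP/negbFE/p0.
    have Xc : sitep a lX = c *: 1.
      have [U1 U2] := (unitaryE U).1 uU.
      rewrite -[LHS]mul1r -U2 -mulrA -[U * _]mulr1 -U2 (mulrA (U * _)) -/(conj_by U _).
      by rewrite Ec -scalerAl -scalerAr mul1r U2.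
    have uXZ : is_unitary (sitep a lX * sitep a lZ).
      by apply: unitary_mul; apply: pauli_unitary; apply: sitep_pauli.
    apply: (unitary_neq0 uXZ); apply: eq_opp0.
    have -> : - (sitep a lX * sitep a lZ) = sitep a lZ * sitep a lX.
      rewrite pt_comm (@psignN1 _ _ a) ?scaleN1r ?opprK //; rewrite /site ?eqxx //.
      by move=> t ta; rewrite (negPf ta).
    by rewrite Xc mulr_algl mulr_algr.
  have [f pf] := lanti_ex pb.
  have ba : b != a by apply: contraNneq pb => ->; rewrite pa.
  have bF : b \in F by apply: contraR pb => /pF ->.
  (* This puts X at [a], while the letter [f] at [b] supplies the single anticommuting site. *)
  pose p' t := if t == a then lX else if t == b then f else p t.
  have [||t ta tb|R [rR RP RQ]] := @pauli_move c c p p' b a b sc sc.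
  - by rewrite /p' (negPf ba) eqxx.
  - by move=> t tb; rewrite /p' (negPf tb); case: eqVneq => [->|_]; rewrite ?pa ?lanti_refl.
  - by rewrite /p' (negPf ta) (negPf tb).
  have [||G [rG GP GQ]] := start c p' sc.
  - move=> t tF; rewrite /p'; case: eqVneq => [e|_]; first by rewrite -e (negPf tF) in aF.
    by case: eqVneq => [e|_]; [rewrite -e (negPf tF) in bF | apply: pF].
  - by rewrite /p' eqxx.
  exists (G * R); split; first by rewrite -[_.+3]addn1; apply: rotcircM.
    by rewrite conj_byM RP GP.
  move=> q q0; rewrite -mulrA RQ ?mulrA ?GQ // => t.
  rewrite /p'; case: (eqVneq t a) => [->|ta]; first by rewrite q0 ?lanti0r.
  by case: (eqVneq t b) => [->|_]; [rewrite q0 ?lanti0r | rewrite lmulaa].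
pose U1 := G1 * U.
have cU1 : is_clifford U1 by apply: clifford_mul => //; apply: rotcirc_clifford rG1.
have U1F q : (forall t, t \in F -> q t = ord0) -> U1 * pt 1 q = pt 1 q * U1.
  by move=> q0; rewrite /U1 -mulrA UF // !mulrA G1Q.
have U1X : conj_by U1 (sitep a lX) = sitep a lX by rewrite conj_byM E G1P.
have [d [r [sd E1 rF]]] := conj_sitep lZ cU1 aF U1F.
(* The images of X and Z at [a] anticommute and the first is again X at [a], so the second has Y or
   Z there. *)
have ra : lanti (r a) lX.
  apply/negPn/negP => na.
  have comm : sitep a lX * pt d r = pt d r * sitep a lX.
    by apply: pt_commute => t; rewrite /site; case: eqVneq => // ->; rewrite lantiC.
  have uXZ : is_unitary (sitep a lX * sitep a lZ).
    by apply: unitary_mul; apply: pauli_unitary; apply: sitep_pauli.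
  have uC : is_unitary (conj_by U1 (sitep a lX * sitep a lZ)).
    apply: unitary_mul; last by apply: unitary_adj; case: cU1.
    by apply: unitary_mul => //; case: cU1.
  have anti : sitep a lX * sitep a lZ = - (sitep a lZ * sitep a lX).
    rewrite pt_comm (@psignN1 _ _ a) ?scaleN1r //; rewrite /site ?eqxx //.
    by move=> t ta; rewrite (negPf ta).
  apply: (unitary_neq0 uC); apply: eq_opp0.
  have -> : - conj_by U1 (sitep a lX * sitep a lZ) = conj_by U1 (sitep a lZ * sitep a lX).
    by rewrite anti /conj_by mulrN mulNr opprK.
  have uU1 := cU1.1; by rewrite !conj_byMr // U1X E1 comm.
(* Up to phase the product of Z and Y is X, so this elimination commutes with X at [a] and keeps
   what [G1] achieved. *)
have [||G2 [rG2 G2P G2Q]] := @pauli_eliminate lZ lY a F _ aF d r sd rF => //.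
  by case: (letterP (r a)) ra.
pose U2 := G2 * U1.
have cU2 : is_clifford U2 by apply: clifford_mul => //; apply: rotcirc_clifford rG2.
have uU2 := cU2.1.
have uG2 := rotcirc_unitary rG2.
have G2X : G2 * sitep a lX = sitep a lX * G2.
  by apply: G2Q => [t _ ta|]; rewrite /site ?(negPf ta) // eqxx.
have U2X : U2 * sitep a lX = sitep a lX * U2.
  by apply: conj_byP => //; rewrite conj_byM U1X conj_by_id.
have U2Z : U2 * sitep a lZ = sitep a lZ * U2.
  by apply: conj_byP => //; rewrite conj_byM E1 G2P.
have U2F q : (forall t, t \in F -> q t = ord0) -> U2 * pt 1 q = pt 1 q * U2.
  move=> q0; rewrite /U2 -mulrA U1F // !mulrA G2Q // => [t tF _|]; first exact: q0.
  by rewrite q0 // lanti0r.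
have U2e e : U2 * sitep a e = sitep a e * U2.
  case: (letterP e) => //.
    by apply: U2F => t _; rewrite /site; case: ifP.
  have -> : sitep a lY = 'i *: (sitep a lX * sitep a lZ).
    rewrite ptM ptZ /pphase (bigD1 a) //= big1 ?mulr1 => [|t ta]; last first.
      by rewrite /site (negPf ta).
    rewrite /site eqxx /lphase /= ?mulr1 ?mul1r mulrN sqr_i opprK.
    by apply: pt_ext => t; rewrite /site; case: ifP.
  move: (sitep a lX) (sitep a lZ) U2X U2Z => A B UA UB.
  by rewrite -scalerAr -scalerAl mulrA UA -[A * U2 * B]mulrA UB mulrA.
have rU2 : rotcirc (n * (2 * #|T| + 5)) U2.
  apply: (IH (F :\ a)) => //; first by rewrite (cardsD1 a) aF in Fn.
  (* A Pauli trivial on [F] without [a] splits into its letter at [a] and a Pauli trivial on [F]. *)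
  move=> q q0; rewrite (pt_split 1 q a) mulrA U2e -[sitep _ _ * U2 * _]mulrA U2F ?mulrA // => t tF.
  by case: eqVneq => // ta; apply: q0; rewrite !inE ta.
have -> : U = adj G1 * (adj G2 * U2).
  have [_ g1] := (unitaryE G1).1 (rotcirc_unitary rG1).
  have [_ g2] := (unitaryE G2).1 uG2.
  by rewrite /U2 (mulrA (adj G2)) g2 mul1r /U1 mulrA g1 mul1r.
have := rotcircM (rotcirc_adj rG1) (rotcircM (rotcirc_adj rG2) rU2).
by apply: rotcirc_le; rewrite mulSn; lia.
Qed.

Lemma clifford_rotcirc U : is_clifford U -> rotcirc (#|T| * (2 * #|T| + 5)) U.
Proof.
move=> cU; apply: (@clifford_rotcirc_aux _ [set: T]) => //; first by rewrite cardsT.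
move=> q q0; have -> : pt 1 q = 1; last by rewrite mulr1 mul1r.
by rewrite -pt1; apply: pt_ext => t; rewrite q0 ?inE.
Qed.

End CliffordDecomposition.

(** * Commutation up to sign, and commutators with a square root of a Pauli *)

Section SignCommutation.
Variables (S : finType) (V : op S).
Implicit Types A B P Q : op S.

Definition scomm A B : Prop := exists2 e, is_sign e & A * B = e *: (B * A).

Lemma pauli_scomm P Q : is_pauli P -> is_pauli Q -> scomm P Q.
Proof. exact: pauli_comm. Qed.
Lemma pauli_adjE P : is_pauli P -> exists2 e, is_sign e & adj P = e *: P.
Proof.
move=> pP; have [e se E] := pauli_sq pP; exists e => //.
have [_ u] := (unitaryE P).1 (pauli_unitary pP).
apply: sign_scaleK => //; rewrite -[LHS]mul1r -u -mulrA E -scalerAr.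
by rewrite mulr1.
Qed.

Lemma scomm_adj A B e : is_unitary A -> is_sign e -> A * B = e *: (B * A) ->
  adj A * B = e *: (B * adj A).
Proof.
rewrite unitaryE => -[u1 u2] se E.
rewrite -[adj A * B]mulr1 -u1 !mulrA -[adj A * B * A]mulrA.
have -> : B * A = e *: (A * B) by apply: sign_scaleK.
by rewrite -scalerAr -scalerAl !mulrA u2 mul1r.
Qed.

Hypothesis cV : is_clifford V.
Hypothesis pVV : is_pauli (V * V).

Let uV : is_unitary V := cV.1.
Let VaV : V * adj V = 1 := uV.1.
Let aVV : adj V * V = 1 := uV.2.

Lemma clifford_conj_pauli P : is_pauli P -> is_pauli (V * P * adj V).
Proof. exact: cV.2. Qed.
(* Since [V * V] is a Pauli, conjugation by [V] sends the commutator of [P] and [V]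
   to its inverse up to sign, and a Pauli is its own inverse up to sign. *)
Lemma commutator_scomm P : is_pauli P -> scomm V (P * (V * adj P * adj V)).
Proof.
move=> pP; have [R RE] : {R | R = V * adj P * adj V} by exists (V * adj P * adj V).
have pR : is_pauli R by rewrite RE; apply: clifford_conj_pauli; apply: pauli_adj.
have [e se E] := pauli_scomm pVV (pauli_adj pP).
have [f sf F] := pauli_adjE pP.
have [h sh H] := pauli_scomm pR pP.
have VR : V * R = e *: (adj P * V).
  rewrite RE !mulrA E -scalerAl; congr (_ *: _).
  by rewrite -!mulrA VaV mulr1.
have VP : V * P = f *: (R * V).
  by rewrite RE -!mulrA aVV mulr1 F -scalerAr scalerA sign_sq // scale1r.
rewrite -RE; exists (f * e * f * h); first by do 3?apply: signM.
rewrite mulrA VP -scalerAl -[R * V * R]mulrA VR -scalerAr F -scalerAl -scalerAr.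
by rewrite (mulrA R P V) H -!scalerAl !scalerA !mulrA.
Qed.

Lemma commutator_pauli P : is_pauli P -> is_pauli (P * (V * adj P * adj V)).
Proof. by move=> pP; apply: pauliM => //; apply: clifford_conj_pauli; apply: pauli_adj. Qed.

End SignCommutation.

(** * Propagation of an error through the gates that meet one block *)

Section Block.
Variables (S T : finType) (g : S -> T) (D : {set T}).
Hypothesis g_inj : injective g.
Hypothesis gD : forall s, g s \in D.
Implicit Types (x y : basis T) (m : basis T -> op S).

(** [D] will be the set of all data qubits. Independence of the whole of [D], not only of the block,
    lets gates on other blocks commute with the multiplexed error. *)
Definition anc_only (A : Type) (m : basis T -> A) : Prop :=
  forall x y, (forall t, t \notin D -> x t = y t) -> m x = m y.

Lemma anc_indep (A : Type) (m : basis T -> A) : anc_only m -> indep g m.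
Proof.
move=> am x y /outeqP xy; apply: am => t tD; apply: xy.
by apply: contraNN tD => /codomP [s ->].
Qed.

Lemma notin_codom c : c \notin D -> c \notin codom g.
Proof. by apply: contraNN => /codomP [s ->]. Qed.

Definition mctrl c (A : op S) : op T := mux g (fun x => if x c then A else 1).

Lemma anc_if (A : Type) c (a b : A) : c \notin D -> anc_only (fun x => if x c then a else b).
Proof. by move=> cD x y xy; rewrite xy. Qed.

Lemma mctrlM c A B : c \notin D -> mctrl c (A * B) = mctrl c A * mctrl c B.
Proof.
move=> cD; rewrite /mctrl muxM //; last by apply: anc_indep; apply: anc_if.
by apply: eq_mux => x; case: ifP; rewrite ?mulr1.
Qed.
Lemma mctrl_adj c A : c \notin D -> adj (mctrl c A) = mctrl c (adj A).
Proof.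
move=> cD; rewrite /mctrl mux_adj; last by apply: anc_indep; apply: anc_if.
by apply: eq_mux => x; case: ifP; rewrite ?adj1.
Qed.
Lemma mctrl1 c : mctrl c 1 = 1.
Proof. by rewrite -(mux1 g_inj); apply: eq_mux => x; rewrite if_same. Qed.
Lemma mctrl_unitary c A : c \notin D -> is_unitary A -> is_unitary (mctrl c A).
Proof.
by move=> cD; rewrite !unitaryE mctrl_adj // -!mctrlM // => -[-> ->]; rewrite mctrl1.
Qed.

Lemma mctrlE c A : c \notin D -> mctrl c A = czop (sitep c lZ) (embed g A).
Proof.
move=> cD; rewrite /czop embedE (mux_z g_inj (notin_codom cD)) -(mux1 g_inj) -muxN.
rewrite -!muxD -!muxZ muxM // -muxD; apply: eq_mux => x.
case: (x c); rewrite ?expr1 ?expr0 ?scaleN1r ?scale1r.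
  by rewrite subrr scaler0 add0r opprK half_double mul1r.
by rewrite subrr scaler0 mul0r addr0 half_double.
Qed.

Lemma embed_sitep s e : embed g (sitep s e) = sitep (g s) e.
Proof.
rewrite [RHS]/sitep (embed_pauli g_inj 1 (p := site (g s) e)) => [|t tg].
  by congr embed; apply: pt_ext => s'; rewrite /site (inj_eq g_inj).
by rewrite /site; case: eqVneq => // e'; rewrite e' codom_f in tg.
Qed.

Lemma rotcirc_mctrl_sitep c s e : c \notin D -> rotcirc 3 (mctrl c (sitep s e)).
Proof.
move=> cD; rewrite mctrlE // embed_sitep; apply: rotcirc_cz; left.
by apply: contraNneq cD => ->.
Qed.

Lemma rotcirc_mctrl_scal c a : c \notin D -> a ^+ 4 = 1 -> rotcirc 2 (mctrl c (a *: 1)).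
Proof.
move=> cD a4; rewrite mctrlE // embedZ embed1 // /czop -scalerAr mulr1 scalerA.
exact: rotcirc_phase.
Qed.

(** One controlled letter per site, at three rotations each; the scalar of the Pauli becomes a phase
    gate on the control. *)
Lemma rotcirc_mctrl_pauli c P : c \notin D -> is_pauli P ->
  rotcirc (3 * #|S| + 2) (mctrl c P).
Proof.
move=> cD [a [p [a4 ->]]]; rewrite cardE.
have : forall s, s \notin enum S -> p s = ord0 by move=> s; rewrite mem_enum.
elim: (enum S) p => [|s r IH] p p0.
  have -> : pauli_tensor a p = a *: 1.
    by rewrite -pt1 ptZ mulr1; apply: pt_ext => s; apply: p0.
  exact: rotcirc_mctrl_scal.
rewrite (pt_split a p s) mctrlM // [size _]/= mulnS -addnA; apply: rotcircM.
  exact: rotcirc_mctrl_sitep.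
apply: IH => s' s'r; case: eqVneq => // ne; apply: p0.
by rewrite inE negb_or ne.
Qed.

Definition chi (J : seq T) x : algC := \prod_(c <- J) (-1) ^+ x c.

Lemma chi_sign J x : is_sign (chi J x).
Proof. by apply: sign_prod => c; apply: sign_bool. Qed.
Lemma chi_anc J : (forall c, c \in J -> c \notin D) -> anc_only (chi J).
Proof. by move=> JD x y xy; apply: eq_big_seq => c /JD /xy ->. Qed.

(** For each [c] in [J], a controlled Z between [b] and [c] produces the sign of [c] on the states
    with [x b]; what remains is the controlled [P]. *)
Lemma rotcirc_chi b J P : b \notin D -> (forall c, c \in J -> c \notin D) ->
  is_pauli P ->
  rotcirc (3 * size J + (3 * #|S| + 2))
    (mux g (fun x => if x b then chi J x *: P else 1)).
Proof.
move=> bD JD pP; elim: J JD => [|c J IH] JD.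
  rewrite (eq_mux g (m' := fun x => if x b then P else 1)); last first.
    by move=> x; rewrite /chi big_nil scale1r.
  by rewrite muln0; apply: rotcirc_mctrl_pauli.
have cD : c \notin D by apply: JD; rewrite mem_head.
have JD' c' : c' \in J -> c' \notin D by move=> cJ; apply: JD; rewrite inE cJ orbT.
have am : anc_only (fun x => if x b then chi J x *: P else 1).
  by move=> x y xy; rewrite xy // (chi_anc JD' xy).
have -> : mux g (fun x => if x b then chi (c :: J) x *: P else 1) =
    czop (sitep b lZ) (sitep c lZ) * mux g (fun x => if x b then chi J x *: P else 1).
  rewrite /czop (mux_z g_inj (notin_codom bD)) (mux_z g_inj (notin_codom cD)).
  rewrite -(mux1 g_inj) -muxN -!muxD -!muxZ muxM //; last first.
    by apply: anc_indep => x y xy; rewrite xy.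
  rewrite -muxD muxM //; last exact: anc_indep; apply: eq_mux => x.
  rewrite /chi big_cons; case: (x b); rewrite ?expr1 ?expr0 ?scaleN1r ?scale1r.
    rewrite subrr scaler0 add0r opprK half_double mul1r.
    by rewrite -scalerAl mul1r scalerA.
  by rewrite subrr scaler0 mul0r addr0 half_double mul1r.
rewrite [size _]/= mulnS -addnA; apply: rotcircM; last exact: IH.
by apply: rotcirc_cz; right.
Qed.

Variable V : op S.
Hypothesis cV : is_clifford V.
Hypothesis pVV : is_pauli (V * V).
Variable Q : op S.
Hypothesis pQ : is_pauli Q.
Hypothesis VQ : scomm V Q.

Let uV : is_unitary V := cV.1.
Let VaV : V * adj V = 1 := uV.1.
Let aVV : adj V * V = 1 := uV.2.

(* [chi J x] is the sign by which [m x] fails to commute with [V] as it did at the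
   start; it stays a character of [x] because the Paulis that commute with [V] up to
   sign do so with [m x] with a sign independent of [x]. *)
Definition block_inv m (J : seq T) : Prop :=
  [/\ anc_only m,
      forall z, is_pauli z -> scomm V z ->
        exists2 d, is_sign d & forall x, m x * z = d *: (z * m x),
      forall x, m x * V = chi J x *: (Q * V * m x) &
      forall c, c \in J -> c \notin D].

(** A sign switched on by [c] is either trivial or itself a factor of a character. *)
Lemma chi_if e c J : is_sign e -> c \notin D -> (forall c, c \in J -> c \notin D) ->
  exists J', [/\ (size J' <= (size J).+1)%N, forall c, c \in J' -> c \notin D &
    forall x, chi J' x = (if x c then e else 1) * chi J x].
Proof.
move=> [] -> cD JD.
  by exists J; split=> // x; rewrite if_same mul1r.
exists (c :: J); split=> // [c'|x].
  by rewrite inE => /orP [/eqP ->|/JD].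
by rewrite /chi big_cons; case: (x c).
Qed.

(** Write [P * V = z * V * P] with the commutator [z]. It commutes with [V] up to sign, so the
    second clause of the invariant lets [m x] pass [z] with a sign independent of [x]. Conjugation
    by the controlled [P] thus alters the third clause only by a sign on the states with [x c],
    which adds at most [c] to the character. *)
Lemma block_inv_pauli m J c P : block_inv m J -> c \notin D -> is_pauli P ->
  exists2 J', (size J' <= (size J).+1)%N &
    block_inv (fun x => if x c then P * m x * adj P else m x) J'.
Proof.
move=> [am mz mV JD] cD pP; have paP := pauli_adj pP.
have uP := pauli_unitary pP; have [PaP aPP] := uP.
rewrite !mulopE in PaP aPP.
have [z sitepZE] : {z | z = P * (V * adj P * adj V)} by eexists.
have pz : is_pauli z by rewrite sitepZE; apply: commutator_pauli.
have Vz : scomm V z by rewrite sitepZE; apply: commutator_scomm.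
have [d sd dE] := mz z pz Vz.
have [e1 s1 E1] := pauli_scomm paP pz.
have [e2 s2 E2] := pauli_scomm pP pQ.
have [e3 s3 E3] := Vz.
have [e4 s4 E4] := pauli_sq pz.
have PV : P * V = z * V * P.
  by rewrite sitepZE -!mulrA (mulrA (adj V)) aVV mul1r aPP mulr1.
have [k kE] : {k | k = e1 * e3 * e4} by eexists.
have k2 : k * k = 1 by rewrite kE; apply: sign_sq; do 2?apply: signM.
(* Multiplying by [z] undoes the commutator, since [z] is its own inverse up to sign. *)
have PVz : P * V * z = k *: (V * P).
  have zP : P * z = e1 *: (z * P).
    have [f sf F] := pauli_adjE pP.
    have PE : P = f *: adj P by apply: sign_scaleK.
    by rewrite {1}PE -scalerAl E1 scalerA [f * _]mulrC -scalerA scalerAr -PE.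
  rewrite PV -mulrA zP -scalerAr mulrA -(mulrA z V z) E3 -scalerAr -scalerAl.
  by rewrite (mulrA z z V) E4 -!scalerAl mul1r kE !scalerA !mulrA.
have aPV : adj P * V = k *: (V * (z * adj P)).
  have := congr1 (fun A => adj P * (A * adj P)) PVz.
  rewrite -!scalerAl -!scalerAr -(mulrA V) PaP mulr1 -!mulrA (mulrA (adj P)) aPP mul1r.
  by move=> ->; rewrite scalerA k2 scale1r.
have [J' [sJ J'D J'E]] := chi_if (signM sd s2) cD JD.
exists J' => //; split=> // [x y xy|z' pz' Vz'|x].
- by rewrite xy // (am _ _ xy).
- have [d' sd' dE'] := mz z' pz' Vz'; exists d' => // x.
  have [e se E] := pauli_scomm pP pz'.
  have F := scomm_adj uP se E.
  case: (x c) => //.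
  rewrite -mulrA F -scalerAr (mulrA (P * m x) z') -(mulrA P (m x) z') dE' -scalerAr (mulrA P z') E.
  rewrite -!scalerAl !scalerA (mulrC d') (mulrA e) sign_sq // mul1r.
  by rewrite !mulrA.
- rewrite J'E; case: (x c); last by rewrite mul1r.
  have h1 : m x * V * z = (chi J x * d) *: (Q * (V * z) * m x).
    by rewrite mV -scalerAl -(mulrA _ (m x) z) dE -scalerAr scalerA !mulrA.
  have h2 : P * (Q * (V * z)) = (e2 * k) *: (Q * V * P).
    by rewrite mulrA E2 -scalerAl -(mulrA Q P) (mulrA P V z) PVz -scalerAr scalerA (mulrA Q).
  have -> : P * m x * adj P * V = k *: (P * (m x * V * z) * adj P).
    by rewrite -(mulrA _ (adj P) V) aPV -scalerAr !mulrA.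
  rewrite h1 -scalerAr (mulrA P) h2 -!scalerAl !scalerA; congr (_ *: _); last by rewrite !mulrA.
  (* [k] enters once on either side of [m x] and cancels, which leaves the sign [d * e2]. *)
  rewrite [RHS](_ : _ = k * k * (d * e2 * chi J x)); last by rewrite k2 mul1r.
  by ring.
Qed.

(** Conjugation by [V] fixes [V] and changes [Q] only by the sign in [scomm V Q], so the character
    grows by at most [b]. *)
Lemma block_inv_psc m J b : block_inv m J -> b \notin D ->
  exists2 J', (size J' <= (size J).+1)%N &
    block_inv (fun x => if x b then V * m x * adj V else m x) J'.
Proof.
move=> [am mz mV JD] bD; have [e se E] := VQ.
have [J' [sJ J'D J'E]] := chi_if se bD JD.
exists J' => //; split=> // [x y xy|z pz Vz|x].
- by rewrite xy // (am _ _ xy).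
- have [d sd dE] := mz z pz Vz; exists d => // x; case: (x b) => //.
  have [f sf F] := Vz; have F' := scomm_adj uV sf F.
  rewrite -mulrA F' -scalerAr (mulrA (V * m x) z) -(mulrA V (m x) z) dE -scalerAr.
  rewrite (mulrA V z) F -!scalerAl !scalerA (mulrC d) (mulrA f) sign_sq // mul1r.
  by rewrite !mulrA.
- rewrite J'E; case: (x b); last by rewrite mul1r.
  rewrite -[LHS]mulrA aVV mulr1 -[LHS]mulr1 -VaV (mulrA _ V) -(mulrA V (m x) V) mV.
  rewrite -scalerAr -scalerAl !(mulrA V) E -!scalerAl scalerA (mulrC e).
  by congr (_ *: _); rewrite !mulrA.
Qed.

(** The third clause of [block_inv], solved for the conjugate: a controlled [V] multiplies the error
    only by a Pauli whose sign depends on the ancillas. *)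
Lemma psc_correction m J x : block_inv m J ->
  V * m x * adj V = (chi J x *: adj Q) * m x.
Proof.
move=> [am mz mV JD]; have [_ aQQ] := (unitaryE Q).1 (pauli_unitary pQ).
have /(congr1 (fun A => adj Q * A * adj V)) := mV x.
rewrite -(mulrA _ _ (adj V)) -(mulrA (m x)) VaV mulr1 => e.
rewrite -scalerAl e -scalerAr -scalerAl scalerA sign_sq ?scale1r; last exact: chi_sign.
by rewrite !mulrA aQQ mul1r.
Qed.

(** The booleans feed the counts in [block_propagation]: the first marks a controlled Pauli on the
    block, the second a controlled [V]. *)
Variant block_gate (G : op T) : bool -> bool -> Prop :=
| BlockStab c s e of c \notin D & G = mctrl c (sitep s e) : block_gate G true false
| BlockPsc c of c \notin D & G = mctrl c V : block_gate G false true
| BlockOther of is_unitary G & (forall m, anc_only m -> G * mux g m = mux g m * G) :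
    block_gate G false false.

Lemma conj_mctrl c A m : c \notin D -> anc_only m ->
  conj_by (mctrl c A) (mux g m) = mux g (fun x => if x c then A * m x * adj A else m x).
Proof.
move=> cD am; rewrite /conj_by mctrl_adj // /mctrl !muxM //.
- by apply: eq_mux => x; case: (x c); rewrite // mul1r mulr1.
- by apply: anc_indep; apply: anc_if.
- exact: anc_indep.
Qed.

(** A controlled Pauli stays a conjugation, with three rotations on either side. A controlled [V]
    leaves its correction, whose size depends on the length of the character, and that length grows
    by at most one per counted gate. *)
Lemma block_propagation (lab : Type) (int : lab -> op T) (isS isP : pred lab)
    (L : seq lab) m J n :
  (forall l, block_gate (int l) (isS l) (isP l)) ->
  block_inv m J -> rotcirc n (mux g m) ->
  rotcirc (n + 6 * count isS L +
     count isP L * (3 * (size J + count isS L + count isP L) + 3 * #|S| + 2))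
    (conj_by (circ (map int L)) (mux g m)).
Proof.
move=> gates; elim: L m J n => [|l L IH] m J n inv rm.
  by rewrite /conj_by /= circ_nil adj1 mulr1 mul1r muln0 !addn0.
rewrite [map _ _]/= circ_cons conj_byM.
have am : anc_only m by case: inv.
rewrite [count isS _]/= [count isP _]/=.
case: (gates l) => [c s e cD|c cD|uG GM] => [->|->|].
- have [J' sJ inv'] := block_inv_pauli inv cD (sitep_pauli s e).
  have rm' : rotcirc (n + 6) (conj_by (mctrl c (sitep s e)) (mux g m)).
    have r3 := rotcirc_mctrl_sitep s e cD.
    apply: rotcirc_le (rotcircM (rotcircM r3 rm) (rotcirc_adj r3)); lia.
  rewrite conj_mctrl // in rm' *; have := IH _ _ _ inv' rm'.
  by apply: rotcirc_le; nia.
- have [J' sJ inv'] := block_inv_psc inv cD.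
  have rm' : rotcirc (n + (3 * size J + (3 * #|S| + 2))) (conj_by (mctrl c V) (mux g m)).
    rewrite conj_mctrl //.
    have -> : mux g (fun x => if x c then V * m x * adj V else m x) =
        mux g (fun x => if x c then chi J x *: adj Q else 1) * mux g m.
      rewrite muxM //; last exact: anc_indep.
      apply: eq_mux => x; rewrite (psc_correction x inv).
      by case: (x c); rewrite ?mul1r.
    rewrite addnC; apply: rotcircM => //; apply: rotcirc_chi => //.
      by case: inv.
    exact: pauli_adj.
  rewrite conj_mctrl // in rm' *; have := IH _ _ _ inv' rm'.
  by apply: rotcirc_le; nia.
- rewrite (conj_by_id uG (GM _ am)).
  exact: IH inv rm.
Qed.

End Block.

(** * The initial errors inside a block *)

Section BlockErrors.
Variables (S T : finType) (g : S -> T) (D : {set T}).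
Hypothesis g_inj : injective g.
Hypothesis gD : forall s, g s \in D.
Variable V : op S.
Hypothesis cV : is_clifford V.
Hypothesis pVV : is_pauli (V * V).
Variables (lab : Type) (int : lab -> op T) (isS isP : pred lab).
Hypothesis gates : forall l, block_gate g D V (int l) (isS l) (isP l).

Let uV : is_unitary V := cV.1.

(** With [Q] the commutator of the error and [V], the invariant holds at the start with the empty
    character. *)
Lemma block_pauli_error c s e (L : seq lab) : c ^+ 4 = 1 ->
  rotcirc (2 + 6 * count isS L +
     count isP L * (3 * (count isS L + count isP L) + 3 * #|S| + 2))
    (conj_by (circ (map int L)) (embed g (c *: sitep s e))).
Proof.
move=> c4; have pE : is_pauli (c *: sitep s e) by apply: pauliZ => //; apply: sitep_pauli.
set E := c *: sitep s e in pE *.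
have uE := pauli_unitary pE; rewrite embedE.
apply: (block_propagation g_inj gD cV pVV (commutator_pauli cV pE)
  (commutator_scomm cV pVV pE) L (J := [::]) gates); last first.
  rewrite -embedE; apply: rotcirc_embed => //; rewrite /E ptZ mulr1.
  apply: (@rotcirc_pauli2 _ _ _ s s) => // t ts _.
  by rewrite /site (negPf ts).
split=> // [z pz _|x].
  have [d sd dE] := pauli_scomm pE pz; by exists d.
rewrite /chi big_nil scale1r; move: uE uV; rewrite !unitaryE => -[_ u2] [_ v2].
by rewrite -!mulrA (mulrA (adj V)) v2 mul1r u2 mulr1.
Qed.

(** Both [V] and its adjoint commute with [V], so the invariant starts with [Q = 1] and the empty
    character. As [adj V] is [V] times the Pauli [adj V * adj V], the error itself is [V] followed
    by one controlled Pauli in the product. *)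
Lemma block_psc_error c (L : seq lab) : c \notin D ->
  rotcirc (#|S| * (2 * #|S| + 5) + (3 * #|S| + 2) + 6 * count isS L +
     count isP L * (3 * (count isS L + count isP L) + 3 * #|S| + 2))
    (conj_by (circ (map int L)) (mux g (fun x => if x c then adj V else V))).
Proof.
move=> cD; have V1 : scomm V 1 by exists 1; [exact: sign1 | rewrite mulr1 mul1r scale1r].
apply: (block_propagation g_inj gD cV pVV (pauli1 S) V1 L (J := [::]) gates); last first.
  have -> : mux g (fun x => if x c then adj V else V) =
      embed g V * mctrl g c (adj V * adj V).
    rewrite embedE muxM //; last by apply: (anc_indep gD); apply: anc_if.
    apply: eq_mux => x; case: (x c); rewrite ?mulr1 // mulrA.
    by case/unitaryE: uV => -> _; rewrite mul1r.
  apply: rotcircM; first by apply: rotcirc_embed => //; apply: clifford_rotcirc.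
  by apply: rotcirc_mctrl_pauli => //; rewrite -adjM; apply: pauli_adj.
split=> // [|z pz [d sd dE]|x]; first exact: anc_if.
  exists d => // x; case: (x c) => //; exact: scomm_adj.
rewrite /chi big_nil scale1r mul1r; case: (x c) => //.
by move: uV; rewrite unitaryE => -[-> ->].
Qed.

End BlockErrors.

(** * Errors on ancillas and what they leave on the blocks *)

Section AncillaErrors.
Variables (T : finType) (D : {set T}).

Lemma czop_mulr (Z B E : op T) e : Z * E = e *: (E * Z) -> B * E = E * B ->
  czop Z B * E = E * czop (e *: Z) B.
Proof.
move=> ZE BE; rewrite /czop mulrDl mulrDr -!scalerAl -!scalerAr -!mulrA BE !(mulrA _ E).
rewrite mulrDl mulrBl ZE mul1r (mulrA E) mulrDr mulrBr mulr1.
by rewrite -!(scalerAl, scalerAr).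
Qed.

Lemma ctrl_mctrl (S : finType) (g : S -> T) c A :
  injective g -> (forall s, g s \in D) -> c \notin D -> ctrl c g A = mctrl g c A.
Proof. by move=> gi gD cD; rewrite ctrl_mux //; apply: (notin_codom gD). Qed.

Lemma mux_z_commute (S : finType) (g : S -> T) c m : injective g ->
  (forall s, g s \in D) -> c \notin D -> anc_only D m ->
  sitep c lZ * mux g m = mux g m * sitep c lZ.
Proof.
move=> gi gD cD am; rewrite (mux_z gi (notin_codom gD cD)) !muxM //.
- by apply: eq_mux => x; rewrite -scalerAl -scalerAr mul1r mulr1.
- by apply: (anc_indep gD) => x y xy; rewrite xy.
- exact: (anc_indep gD).
Qed.

Lemma block_gate_other (S S' : finType) (g : S -> T) (g' : S' -> T) c A V :
  injective g -> (forall s, g s \in D) -> injective g' -> (forall s, g' s \in D) ->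
  (forall s s', g s != g' s') -> c \notin D -> is_unitary A ->
  block_gate g D V (ctrl c g' A) false false.
Proof.
move=> gi gD gi' gD' dis cD uA; rewrite (ctrl_mctrl _ gi' gD' cD); constructor.
  exact: (mctrl_unitary gi' gD').
move=> m am; rewrite (mctrlE gi' gD') // -{2}(scale1r (sitep c lZ)).
apply: czop_mulr; first by rewrite scale1r; apply: mux_z_commute.
by rewrite mux_embedC //; apply: (anc_indep gD').
Qed.

(** An error that commutes with Z on the control passes. Otherwise it negates that Z, which
    exchanges the two branches of the gate; composing the exchanged gate with the adjoint of [G]
    leaves [A] on one branch and its adjoint on the other. *)
Lemma ancilla_error_gate (S : finType) (g : S -> T) c q0 a e A :
  injective g -> (forall s, g s \in D) -> c \notin D -> q0 \notin D -> is_unitary A ->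
  let E := a *: sitep q0 e in let G := ctrl c g A in
  conj_by G E = E \/
  c = q0 /\ conj_by G E = E * mux g (fun x => if x c then adj A else A).
Proof.
move=> gi gD cD qD uA E G.
have GE : G = mctrl g c A := ctrl_mctrl _ gi gD cD.
have uG : is_unitary G by rewrite GE; apply: (mctrl_unitary gi gD).
have inj1 : injective (fun _ : 'I_1 => q0) by move=> i j _; rewrite !ord1.
have BE : embed g A * E = E * embed g A.
  rewrite /E -scalerAl -scalerAr -(embed_sitep inj1 ord0) [in LHS]embedE mux_embedC //.
  by move=> s _; apply: contraNneq qD => <-.
have [f sf F] : exists2 f, is_sign f & sitep c lZ * E = f *: (E * sitep c lZ).
  have [f sf F] := pauli_comm (sitep_pauli c lZ) (sitep_pauli q0 e).
  rewrite /E; move: (sitep c lZ) (sitep q0 e) F => Z X F; exists f => //.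
  by rewrite -scalerAr F -scalerAl !scalerA (mulrC a).
case: (eqVneq c q0) => [cq|cq]; last first.
  left; apply: conj_by_id => //; rewrite GE (mctrlE gi gD) //.
  rewrite (@czop_mulr _ _ _ 1) ?scale1r // /E.
  have : sitep c lZ * sitep q0 e = sitep q0 e * sitep c lZ.
    apply: pt_commute => t; rewrite /site; case: eqVneq => // ->.
    by rewrite (negPf cq) lanti0r.
  by move: (sitep c lZ) (sitep q0 e) => Z X ZX; rewrite -scalerAr -scalerAl ZX.
case: sf F => -> F.
  by left; apply: conj_by_id => //; rewrite GE (mctrlE gi gD) // (czop_mulr F BE) scale1r.
right; split=> //; rewrite /conj_by {1}GE (mctrlE gi gD) // (czop_mulr F BE) -mulrA.
congr (_ * _).
have -> : czop (-1 *: sitep c lZ) (embed g A) = mux g (fun x => if x c then 1 else A).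
  rewrite /czop embedE (mux_z gi (notin_codom gD cD)) -(mux1 gi) -muxZ -muxN.
  rewrite -!muxD -!muxZ muxM // -muxD; apply: eq_mux => x.
  case: (x c); rewrite ?expr1 ?expr0 !scaleN1r ?scale1r ?opprK.
    by rewrite subrr scaler0 mul0r addr0 half_double.
  by rewrite subrr scaler0 add0r half_double mul1r.
rewrite GE (mctrl_adj gD) // muxM //; last by apply: (anc_indep gD); apply: anc_if.
by apply: eq_mux => x; case: (x c); rewrite ?mul1r ?mulr1.
Qed.

(** The error itself survives every gate; a gate satisfying [isC] may leave a factor [F l], which
    then propagates through the later gates [L2] independently of the other factors. *)
Lemma ancilla_error (lab : Type) (int : lab -> op T) (isC : pred lab)
    (F : lab -> op T) (E : op T) n C (L : seq lab) :
  rotcirc n E -> (forall l, is_unitary (int l)) ->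
  (forall l, conj_by (int l) E = E \/ isC l /\ conj_by (int l) E = E * F l) ->
  (forall L1 l L2, L = L1 ++ l :: L2 -> isC l ->
     rotcirc C (conj_by (circ (map int L2)) (F l))) ->
  rotcirc (n + count isC L * C) (conj_by (circ (map int L)) E).
Proof.
move=> rE uint step; elim: L => [|l L IH] rF.
  by rewrite /conj_by /= circ_nil adj1 mulr1 mul1r addn0.
have {}IH : rotcirc (n + count isC L * C) (conj_by (circ (map int L)) E).
  by apply: IH => L1 l' L2 LE; apply: (rF (l :: L1)); rewrite LE.
rewrite [map _ _]/= circ_cons conj_byM; case: (step l) => [->|[Cl ->]].
  by apply: rotcirc_le IH => /=; nia.
rewrite conj_byMr; last by apply: circ_unitary; elim: L {IH rF} => //= l' L' IH'; split.
apply: rotcirc_le (rotcircM IH (rF [::] l L erefl Cl)).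
by rewrite /= Cl; nia.
Qed.

End AncillaErrors.

(** * Labels and counts of the gates of a protocol *)

Lemma count_pmap (A B : Type) (p : pred B) (f : A -> option B) s :
  count p (pmap f s) = count (fun x => if f x is Some y then p y else false) s.
Proof. by elim: s => //= x s IH; case: (f x) => [y|] /=; rewrite IH. Qed.

Lemma count_flatten_le (A B : Type) (p : pred B) (f : A -> seq B) s C :
  (forall x, (count p (f x) <= C)%N) ->
  (count p (flatten (map f s)) <= size s * C)%N.
Proof.
move=> fC; elim: s => //= x s IH; rewrite count_cat mulSn.
exact: leq_add.
Qed.

(** Serves for the gates of a fixed ancilla, which belongs to a single round [a]. *)
Lemma count_flatten_le1 (A : eqType) (B : Type) (p : pred B) (f : A -> seq B) s a C :
  uniq s -> (forall x, x != a -> count p (f x) = 0%N) -> (count p (f a) <= C)%N ->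
  (count p (flatten (map f s)) <= C)%N.
Proof.
move=> + f0 fa; suff : (uniq s -> count p (flatten (map f s)) <= (a \in s) * C)%N.
  by move=> h /h; case: (a \in s) => ?; lia.
elim: s => //= x s IH /andP [xs /IH {}IH]; rewrite count_cat inE.
case: (eqVneq a x) => [ax|ax]; last by rewrite f0 1?eq_sym.
by rewrite -ax in xs *; rewrite (negPf xs) mul0n in IH; lia.
Qed.

Section Counting.
Variable P : protocol.

(** Gates are named by ancilla and target so that they can be counted; the bare operators do not
    carry these data. *)
Definition lab : finType := (stab_anc P * 'I_(pn P) + psc_anc P * 'I_(pl P))%type.
Definition lab_ctrl (l : lab) : qubit P :=
  match l with inl (a, _) => inl (inr a) | inr (a, _) => inr a end.
Definition lab_gate (l : lab) : op (qubit P) :=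
  match l with
  | inl (a, j) => ctrl (inl (inr a) : qubit P) (fun _ : 'I_1 => data j)
                       (sigma1 (pP (val a).2 j))
  | inr (a, i) => ctrl (inr a : qubit P) (fun q => data (pf i q)) (pV i)
  end.

Definition stab_labels (t : 'I_(pr P)) : seq lab :=
  pmap (fun ij : 'I_(pm P) * 'I_(pn P) =>
    omap (fun a : stab_anc P => inl (a, ij.2) : lab) (insub (t, ij.1))) (psched t).
Definition psc_labels (t : 'I_(pr P)) : seq lab :=
  if insub t is Some a then [seq inr (a, i) | i <- plsched t] else [::].
Definition round_labels t : seq lab := if prk t then stab_labels t else psc_labels t.
Definition labels : seq lab := flatten [seq round_labels t | t <- enum 'I_(pr P)].

Lemma gates_labels : gates P = map lab_gate labels.
Proof.
rewrite /gates /labels map_flatten -map_comp; congr flatten; apply: eq_map => t /=.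
rewrite /round_gates /round_labels; case: (prk t).
  rewrite /stab_round_gates /stab_labels.
  elim: (psched t) => //= [[i j] s IH] /=; case: insubP => [a _ av|_] /=; last exact: IH.
  by rewrite IH av.
rewrite /psc_round_gates /psc_labels; case: insubP => [a _ _|_] //.
by rewrite -map_comp.
Qed.

Definition datas : {set qubit P} := [set q | if q is inl (inl _) then true else false].

Lemma data_datas (j : 'I_(pn P)) : data j \in datas. Proof. by rewrite inE. Qed.
Lemma ctrl_datas l : lab_ctrl l \notin datas.
Proof. by rewrite inE; case: l => -[]. Qed.
Lemma data_inj : injective (@data P). Proof. by move=> i j []. Qed.

Variable s : nat.
Hypothesis vP : valid_protocol P s.

(** The schedule permutes the nonzero entries of the parity check matrix, so counting becomes
    summation over rows or columns. The default [false] is not reached, since [prk t] makes [insub]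
    succeed. *)
Lemma stab_round_count (p : pred lab) t : prk t ->
  (count p (round_labels t) <=
   \sum_(i < pm P) \sum_(j < pn P) (Hmx i j && if insub (t, i) is Some a then p (inl (a, j)) else false))%N.
Proof.
move=> kt; rewrite /round_labels kt count_pmap.
have /permP -> : perm_eq (psched t) [seq ij <- enum {: 'I_(pm P) * 'I_(pn P)} | Hmx ij.1 ij.2].
  by case: vP => + _ _ _ _; apply.
rewrite count_filter -sum1_count big_enum_cond /= pair_big /= big_mkcond /=.
apply: leq_sum => -[i j] _ /=; case: (insub (t, i)) => [a|] /=; rewrite ?andbF //.
by rewrite andbC; case: (_ && _).
Qed.

Lemma psc_round_count (p : pred lab) t : ~~ prk t ->
  exists2 a : psc_anc P, val a = t &
  (count p (round_labels t) = count (fun i => p (inr (a, i))) (enum 'I_(pl P))).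
Proof.
move=> kt; rewrite /round_labels (negPf kt) /psc_labels.
case: insubP => [a _ av|]; last by rewrite kt.
exists a => //; rewrite count_map; apply/permP.
by case: vP => _ + _ _ _; apply.
Qed.

Definition on_stab k (g : 'I_k -> 'I_(pn P)) (l : lab) : bool :=
  if l is inl (_, j) then j \in codom g else false.
Definition on_psc (pi : pred 'I_(pl P)) (l : lab) : bool :=
  if l is inr (_, i) then pi i else false.

(** In each round a column of the matrix contributes at most [wq P], and the block has at most [k]
    columns. *)
Lemma count_on_stab k (g : 'I_k -> 'I_(pn P)) :
  (count (on_stab g) labels <= pr P * (k * wq P))%N.
Proof.
rewrite -[X in (_ <= X * _)%N](size_enum_ord (pr P)); apply: count_flatten_le => t.
have [kt|kt] := boolP (prk t); last first.
  by have [a _ ->] := psc_round_count (on_stab g) kt; rewrite count_pred0.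
apply: leq_trans (stab_round_count _ kt) _; rewrite exchange_big /=.
apply: (@leq_trans (\sum_(j in codom g) wq P)); last first.
  by rewrite sum_nat_const leq_mul2r (leq_trans (card_size _)) ?orbT // size_codom card_ord.
rewrite [X in (_ <= X)%N]big_mkcond /=; apply: leq_sum => j _.
case: ifP => jg; last first.
  by rewrite big1 // => i _; case: insub => [a|] /=; rewrite ?jg andbF.
apply: (@leq_trans #|[set i | Hmx i j]|); last exact: (leq_bigmax j).
rewrite -sum1_card [X in (_ <= X)%N]big_mkcond /=; apply: leq_sum => i _.
by rewrite inE; case: (Hmx i j); case: insub => [a|] //=; case: ifP.
Qed.

Lemma count_on_psc (pi : pred 'I_(pl P)) : (count pi (enum 'I_(pl P)) <= 1)%N ->
  (count (on_psc pi) labels <= pr P)%N.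
Proof.
move=> pi1; rewrite -[X in (_ <= X)%N]muln1 -[X in (_ <= X * _)%N](size_enum_ord (pr P)).
apply: count_flatten_le => t; have [kt|kt] := boolP (prk t).
  apply: leq_trans (stab_round_count _ kt) _.
  by rewrite big1 // => i _; rewrite big1 // => j _; case: insub => [a|]; rewrite andbF.
by have [a _ ->] := psc_round_count (on_psc pi) kt.
Qed.

Definition ctrl_by (q : qubit P) (l : lab) : bool := lab_ctrl l == q.

(** A data qubit controls nothing, a stabilizer ancilla one row of the matrix, a PSC ancilla the
    factors of its round; the sum covers all three cases. *)
Lemma count_ctrl_by q : (count (ctrl_by q) labels <= wc P + pl P)%N.
Proof.
case: q => [[j|a]|a].
- rewrite (@eq_count _ _ pred0) ?count_pred0 // => l.
  by apply/negbTE; case: l => -[].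
- apply: (count_flatten_le1 (enum_uniq _) (a := (val a).1)) => [t ta|].
    have [kt|kt] := boolP (prk t); last first.
      by have [b _ ->] := psc_round_count (ctrl_by (inl (inr a))) kt; rewrite count_pred0.
    apply/eqP; rewrite -leqn0; apply: leq_trans (stab_round_count _ kt) _.
    rewrite leqn0; apply/eqP; rewrite big1 // => i _; rewrite big1 // => j _.
    case: insubP => [b _ bv|]; rewrite ?andbF //.
    rewrite [ctrl_by _ _](_ : _ = false) ?andbF //; apply/negbTE.
    by apply: contraNneq ta => -[<-]; rewrite bv.
  have kt : prk (val a).1 by exact: (valP a).
  apply: leq_trans (stab_round_count _ kt) _.
  apply: (@leq_trans #|[set j | Hmx (val a).2 j]|); last first.
    by apply: leq_trans (leq_addr _ _); apply: (leq_bigmax (val a).2).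
  rewrite (bigD1 (val a).2) //= [X in (_ + X)%N]big1 ?addn0 => [|i ia].
    rewrite -sum1_card [X in (_ <= X)%N]big_mkcond /=; apply: leq_sum => j _.
    by rewrite inE; case: (Hmx _ j) => //=; case: insub => [b|] //; case: ctrl_by.
  rewrite big1 // => j _; case: insubP => [b _ bv|]; rewrite ?andbF //.
  rewrite [ctrl_by _ _](_ : _ = false) ?andbF //; apply/negbTE.
  by apply: contraNneq ia => -[<-]; rewrite bv.
- apply: (count_flatten_le1 (enum_uniq _) (a := val a)) => [t ta|].
    have [kt|kt] := boolP (prk t).
      apply/eqP; rewrite -leqn0; apply: leq_trans (stab_round_count _ kt) _.
      rewrite leqn0; apply/eqP; rewrite big1 // => i _; rewrite big1 // => j _.
      by case: insub => [b|]; rewrite andbF.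
    have [b bv ->] := psc_round_count (ctrl_by (inr a)) kt.
    rewrite (@eq_count _ _ pred0) ?count_pred0 // => i; apply/negbTE.
    by apply: contraNneq ta => -[<-]; rewrite bv.
  have [b _ ->] := psc_round_count (ctrl_by (inr a)) (valP a).
  apply: leq_trans (count_size _ _) _.
  by rewrite size_enum_ord leq_addl.
Qed.

End Counting.

Lemma sigma1E e : sigma1 e = sitep ord0 e.
Proof.
apply: opP => x y; rewrite sitepE.
have -> : [forall t, (t != ord0) ==> (x t == y t)]; last by rewrite mulr1.
by apply/forallP => t; rewrite ord1.
Qed.

(** A nonzero entry in some column also lies in a row. Positivity of [wc P] later absorbs additive
    constants. *)
Lemma wc_gt0 P : (0 < wq P)%N -> (0 < wc P)%N.
Proof.
move=> wq_gt0.
rewrite lt0n; apply: contraTneq wq_gt0 => wc0; rewrite -eqn0Ngt -leqn0.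
apply/bigmax_leqP => j _; rewrite leqn0 cards_eq0; apply/eqP/setP => i.
rewrite !inE; apply/negbTE/negP => Hij.
have : (#|[set j | Hmx i j]| <= wc P)%N by exact: (leq_bigmax i).
rewrite wc0 leqn0 cards_eq0 => /eqP/setP/(_ j).
by rewrite !inE Hij.
Qed.

(** * Assembling the bounds for a valid protocol *)

Section ProtocolErrors.
Variables (P : protocol) (s : nat).
Hypothesis vP : valid_protocol P s.
Hypothesis r_gt0 : (0 < pr P)%N.
Hypothesis wq_gt0 : (0 < wq P)%N.

Let dD (S : Type) (g : S -> 'I_(pn P)) x : data (g x) \in datas P.
Proof. exact: data_datas. Qed.

Lemma pf_inj i : injective (fun q => data (pf i q) : qubit P).
Proof. by case: vP => _ _ + _ _ => /(_ i) [pi _ _] a b /data_inj/pi. Qed.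

Lemma pV_clifford i : is_clifford (@pV P i).
Proof. by case: vP => _ _ + _ _ => /(_ i) [_ [? _] _]. Qed.

Lemma pVV_pauli i : is_pauli (@pV P i * pV i).
Proof. by case: vP => _ _ + _ _ => /(_ i) [_ [_ [_ ?]] _]. Qed.

Lemma const_inj j : injective (fun _ : 'I_1 => data j : qubit P).
Proof. by move=> a b _; rewrite !ord1. Qed.

Lemma sigma1_unitary e : is_unitary (sigma1 e).
Proof. by rewrite sigma1E; apply: pauli_unitary; apply: sitep_pauli. Qed.

Lemma lab_gate_unitary l : is_unitary (@lab_gate P l).
Proof.
have cD := ctrl_datas l; case: l cD => -[a j] cD /=.
  rewrite (ctrl_mctrl _ (@const_inj j) (dD (fun=> j)) cD).
  by apply: (mctrl_unitary (@const_inj j) (dD (fun=> j))) => //; apply: sigma1_unitary.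
rewrite (ctrl_mctrl _ (@pf_inj j) (dD (pf j)) cD).
by apply: (mctrl_unitary (@pf_inj j) (dD (pf j))) => //; case: (pV_clifford j).
Qed.

Lemma stab_block_gate k (g : 'I_k -> 'I_(pn P)) (V : op 'I_k) a j : injective g ->
  block_gate (fun q => data (g q)) (datas P) V (lab_gate (inl (a, j))) (j \in codom g) false.
Proof.
move=> gi; have gi' : injective (fun q => data (g q)) by move=> x y /data_inj/gi.
have cD : inl (inr a) \notin datas P := ctrl_datas (inl (a, j)).
have [/codomP [q jq]|jg] := boolP (j \in codom g).
  apply: (BlockStab _ (s := q) (e := pP (val a).2 j) cD).
  transitivity (mctrl (fun _ : 'I_1 => data j) (inl (inr a) : qubit P) (sigma1 (pP (val a).2 j))).
    exact: (ctrl_mctrl _ (@const_inj j) (dD (fun=> j)) cD).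
  rewrite (mctrlE (@const_inj j) (dD (fun=> j)) _ cD) (mctrlE gi' (dD g) _ cD).
  by rewrite sigma1E (embed_sitep (@const_inj j)) (embed_sitep gi') -jq.
apply: (block_gate_other V gi' (dD g) (@const_inj j) (dD (fun=> j))) => //.
  by move=> q _; apply: contraNneq jg => /data_inj <-; apply: codom_f.
exact: sigma1_unitary.
Qed.

Lemma psc_block_gate k (g : 'I_k -> 'I_(pn P)) (V : op 'I_k) a i : injective g ->
  (forall q q', g q != pf i q') ->
  block_gate (fun q => data (g q)) (datas P) V (lab_gate (inr (a, i))) false false.
Proof.
move=> gi dis; have gi' : injective (fun q => data (g q)) by move=> x y /data_inj/gi.
apply: (block_gate_other V gi' (dD g) (@pf_inj i) (dD (pf i))).
- by move=> q q'; apply: contraNneq (dis q q') => /data_inj ->.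
- exact: (ctrl_datas (inr (a, i))).
- by case: (pV_clifford i).
Qed.

Lemma psc_block i l :
  block_gate (fun q => data (pf i q)) (datas P) (pV i) (lab_gate l)
    (on_stab (pf i) l) (on_psc (pred1 i) l).
Proof.
have gi : injective (pf i) by case: vP => _ _ + _ _ => /(_ i) [].
case: l => -[a j] /=; first exact: stab_block_gate.
have [->|ji] := eqVneq j i.
  apply: BlockPsc (ctrl_datas (inr (a, i))) _ => /=.
  exact: (ctrl_mctrl _ (@pf_inj i) (dD (pf i)) (ctrl_datas (inr (a, i)))).
apply: psc_block_gate => // q q'.
by case: vP => _ _ _ + _; apply; rewrite eq_sym.
Qed.

(** A data qubit outside all supports is a block of its own; [1] takes the place of [V], and no gate
    counts as a controlled [V]. *)
Lemma free_block j l : (forall i q, pf i q != j) ->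
  block_gate (fun _ : 'I_1 => data j) (datas P) 1 (lab_gate l)
    (on_stab (fun _ : 'I_1 => j) l) (on_psc pred0 l).
Proof.
move=> free; have gi : injective (fun _ : 'I_1 => j) by move=> a b _; rewrite !ord1.
case: l => -[a i] /=; first exact: (stab_block_gate 1 a i gi).
by apply: (psc_block_gate 1 a gi) => q q'; rewrite eq_sym.
Qed.

(** Of the part of the circuit that follows the error, only the gate counts enter the bounds. *)
Definition counts_le_labels (L : seq (lab P)) : Prop :=
  forall p, (count p L <= count p (labels P))%N.

Let W := (pr P ^ 2 * wq P)%N.

(** The product [y * x] is what brings in r^2 w_q; positivity of r and w_q absorbs the other terms
    into [W]. The bound [s.+1] also covers the one-qubit blocks when [s = 0]. *)
Lemma propagation_bound k x y n : (k <= s.+1)%N -> (x <= pr P * (k * wq P))%N ->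
  (y <= pr P)%N ->
  (n + 6 * x + y * (3 * (x + y) + 3 * k + 2) <= (n + 12 * s.+1 + 5) * W)%N.
Proof.
move=> ks hx hy.
have W1 : (pr P * wq P <= W)%N by rewrite /W expnS expn1; nia.
have W2 : (pr P * pr P <= W)%N by rewrite /W expnS expn1; nia.
have W3 : (pr P <= W)%N by nia.
have W4 : (1 <= W)%N by lia.
have x1 : (x <= s.+1 * W)%N by nia.
have xy : (y * x <= s.+1 * W)%N.
  apply: leq_trans (leq_mul hy hx) _; rewrite /W expnS expn1.
  have -> : (pr P * (pr P * (k * wq P)) = k * (pr P * pr P * wq P))%N by lia.
  by rewrite leq_mul2r ks orbT.
have yy : (y * y <= W)%N by apply: leq_trans (leq_mul hy hy) W2.
have yk : (y * k <= s.+1 * W)%N.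
  by rewrite mulnC; apply: leq_mul => //; apply: leq_trans hy W3.
have -> : (y * (3 * (x + y) + 3 * k + 2) =
  3 * (y * x) + 3 * (y * y) + 3 * (y * k) + 2 * y)%N by nia.
have : (n <= n * W)%N by nia.
have : (y <= W)%N by lia.
by rewrite !mulnDl -!mulnA; lia.
Qed.

Lemma data_error_propagation j c e L : c ^+ 4 = 1 -> counts_le_labels L ->
  rotcirc ((12 * s.+1 + 7) * W)
    (conj_by (circ (map (@lab_gate P) L)) (c *: sitep (data j) e)).
Proof.
move=> c4 sL.
have bound k x y : (k <= s.+1)%N -> (x <= pr P * (k * wq P))%N -> (y <= pr P)%N ->
  (2 + 6 * x + y * (3 * (x + y) + 3 * k + 2) <= (12 * s.+1 + 7) * W)%N.
  move=> ks hx hy; apply: leq_trans (propagation_bound 2 ks hx hy) _.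
  by rewrite leq_mul2r; apply/orP; right; lia.
(* The block is the support of a factor containing [j], if there is one, and [j] alone otherwise. *)
case: (pickP (fun i => j \in codom (@pf P i))) => [i /codomP [q jq]|free].
  have ks : (pk i <= s)%N by case: vP => _ _ + _ _ => /(_ i) [].
  have -> : c *: sitep (data j) e = embed (fun q => data (pf i q)) (c *: sitep q e).
    by rewrite embedZ (embed_sitep (@pf_inj i)) -jq.
  apply: rotcirc_le (block_pauli_error (@pf_inj i) (dD (pf i)) (pV_clifford i)
    (pVV_pauli i) (psc_block i) q e L c4).
  rewrite card_ord; apply: bound; first exact: leqW.
    exact: leq_trans (sL _) (count_on_stab vP _).
  apply: leq_trans (sL _) (count_on_psc vP _).
  by rewrite (count_uniq_mem _ (enum_uniq _)); case: (_ \in _).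
have free' i q : pf i q != j.
  by apply: contraFneq (free i) => <-; apply: codom_f.
have -> : c *: sitep (data j) e = embed (fun _ : 'I_1 => data j) (c *: sitep ord0 e).
  by rewrite embedZ (embed_sitep (@const_inj j)).
have p11 : is_pauli (1 * 1 : op 'I_1) by rewrite mulr1; apply: pauli1.
apply: rotcirc_le (block_pauli_error (@const_inj j) (dD (fun=> j))
  (rotcirc_clifford (rotcirc1 _ 0)) p11 (fun l => free_block l free') ord0 e L c4).
rewrite card_ord; apply: bound => //.
  exact: leq_trans (sL _) (count_on_stab vP _).
by apply: leq_trans (sL _) (count_on_psc vP _); rewrite count_pred0.
Qed.

Lemma psc_error_propagation i c L : c \notin datas P -> counts_le_labels L ->
  rotcirc ((s.+1 * (2 * s.+1 + 5) + (3 * s.+1 + 2) + 12 * s.+1 + 5) * W)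
    (conj_by (circ (map (@lab_gate P) L))
      (mux (fun q => data (pf i q)) (fun x => if x c then adj (pV i) else pV i))).
Proof.
move=> cD sL; have ks : (pk i <= s)%N by case: vP => _ _ + _ _ => /(_ i) [].
apply: rotcirc_le (block_psc_error (@pf_inj i) (dD (pf i)) (pV_clifford i)
  (pVV_pauli i) (psc_block i) L cD).
rewrite card_ord.
apply: leq_trans (propagation_bound _ (leqW ks) _ _) _.
- exact: leq_trans (sL _) (count_on_stab vP _).
- apply: leq_trans (sL _) (count_on_psc vP _).
  by rewrite (count_uniq_mem _ (enum_uniq _)); case: (_ \in _).
by rewrite leq_mul2r; apply/orP; right; nia.
Qed.

(** Dominates the constants of both kinds of residual error. *)
Let C := (s.+1 * (2 * s.+1 + 5) + (3 * s.+1 + 2) + 12 * s.+1 + 7)%N.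

(** What a gate leaves behind when its control is flipped. A Pauli letter is its own adjoint, so the
    first case does not depend on the ancilla. *)
Definition lab_error (l : lab P) : op (qubit P) :=
  match l with
  | inl (a, j) => sitep (data j) (pP (val a).2 j)
  | inr (a, i) => mux (fun q => data (pf i q))
                    (fun x => if x (inr a) then adj (pV i) else pV i)
  end.

Lemma lab_gate_error q0 a e (l : lab P) : q0 \notin datas P ->
  let E := a *: sitep q0 e in
  conj_by (lab_gate l) E = E \/
  ctrl_by q0 l /\ conj_by (lab_gate l) E = E * lab_error l.
Proof.
move=> qD E; have cD := ctrl_datas l; case: l cD => -[b j] cD /=.
  have [->|[cq ->]] := ancilla_error_gate a e (@const_inj j) (dD (fun=> j)) cD qD
    (sigma1_unitary (pP (val b).2 j)); first by left.
  right; split; first exact/eqP.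
  congr (_ * _); rewrite -(embed_sitep (@const_inj j) ord0) embedE.
  by apply: eq_mux => x; rewrite sigma1E sitep_adj if_same.
have [->|[cq ->]] := ancilla_error_gate a e (@pf_inj j) (dD (pf j)) cD qD
  (pV_clifford j).1; first by left.
by right; split; first exact/eqP.
Qed.

(** A data error is one block error, covered because [wc P] is positive. An ancilla error costs two
    rotations itself and leaves residual errors at no more than the [wc P + pl P] gates that the
    ancilla can control. *)
Lemma error_propagation q c e L : c ^+ 4 = 1 -> counts_le_labels L ->
  rotcirc (2 + (wc P + pl P) * (C * W))
    (conj_by (circ (map (@lab_gate P) L)) (c *: sitep q e)).
Proof.
move=> c4 sL; have wc0 := wc_gt0 wq_gt0.
have [|qD] := boolP (q \in datas P).
  rewrite inE; case: q => [[j|?]|?] // _.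
  apply: rotcirc_le (data_error_propagation j e c4 sL).
  by rewrite /C; nia.
apply: rotcirc_le (ancilla_error (n := 2) (C := C * W) _ lab_gate_unitary
  (fun l => lab_gate_error c e l qD) _).
- rewrite leq_add2l leq_mul2r; apply/orP; right.
  exact: leq_trans (sL _) (count_ctrl_by vP _).
- rewrite ptZ mulr1; apply: (@rotcirc_pauli2 _ _ _ q q) => // t tq _.
  by rewrite /site (negPf tq).
move=> L1 l L2 LE _.
have sL2 : counts_le_labels L2.
  by move=> p; apply: leq_trans (sL p); rewrite LE count_cat /=; lia.
case: l LE => -[b j] _ /=.
  rewrite -[sitep _ _]scale1r.
  apply: rotcirc_le (data_error_propagation j _ (expr1n _ 4) sL2).
  by rewrite leq_mul2r; apply/orP; right; rewrite /C; lia.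
apply: rotcirc_le (psc_error_propagation j (ctrl_datas (inr (b, j))) sL2).
by rewrite leq_mul2r; apply/orP; right; rewrite /C; lia.
Qed.

End ProtocolErrors.

(** [s] bounds the size of every factor, so [K] is a constant when the factors act on O(1) qubits.
    Rounds and [wq P] are positive because the bound would otherwise allow no gate at all, although
    the inserted error may remain. *)
Theorem theorem2 :
  forall s : nat, exists K : nat,
  forall P : protocol, valid_protocol P s ->
  (0 < pr P)%N -> (0 < wq P)%N ->
  forall (loc : nat) (E : op (qubit P)),
    (loc <= size (gates P))%N -> single_qubit_pauli E ->
    let W2 := circ (drop loc (gates P)) in
    exists gs : seq (op (qubit P)),
      [/\ all_prop (@small_clifford_gate _) gs,
          (size gs <= K * ((pr P) ^ 2 * wq P * (wc P + pl P)))%N &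
          mulop (mulop W2 E) (adj W2) = circ gs].
Proof.
(* The constant of [error_propagation] plus three: two for the error on an ancilla itself and one
   for the global phase. *)
move=> s; exists (s.+1 * (2 * s.+1 + 5) + (3 * s.+1 + 2) + 12 * s.+1 + 7 + 3)%N.
move=> P vP r0 w0 loc E _ [c [q [a [c4 ->]]]] W2.
have -> : mulop (mulop W2 (pauli_tensor c (fun t => if t == q then a else ord0))) (adj W2) =
    conj_by (circ (map (@lab_gate P) (drop loc (labels P)))) (c *: sitep q a).
  by rewrite map_drop -gates_labels ptZ mulr1.
have sL : counts_le_labels (drop loc (labels P)).
  by move=> p; rewrite -{2}(cat_take_drop loc (labels P)) count_cat leq_addl.
have [gs [sgs ngs ->]] := rotcirc_small q (error_propagation vP r0 w0 q a c4 sL).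
exists gs; split=> //; apply: leq_trans ngs _.
have := wc_gt0 w0; set C := (_ + 7)%N; rewrite mulnDl -addSn -addn1 -addSn; nia.
Qed.
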